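(* Let $G$ be a finitely generated discrete group. Then the following conditions are equivalent: (1) There exists a sequence $(g_k)_{k\in\mathbb{N}}$ of non-trivial elements of $G$ (i.e. $g_k\neq e$ for all $k$) which is strongly Bohr convergent to the neutral element. (2) The group $G$ is not virtually abelian.
   Context: A sequence $(g_k)_{k\in\mathbb{N}}$ of elements of a discrete group $G$ is called Bohr convergent to the neutral element if $\pi(g_k)\to 1$ as $k\to\infty$ for every homomorphism $\pi\colon G\to K$ to a compact (Hausdorff topological) group $K$. It is called strongly Bohr convergent to the neutral element if it is Bohr convergent to the neutral element and moreover $\pi(g_k)$ converges uniformly to the identity in unitary representations of a fixed finite dimension, i.e. for every $n\in\mathbb{N}$, $\sup\{\|1_n-\pi(g_k)\| : \pi\colon G\to U(n) \text{ a homomorphism}\}\to 0$ as $k\to\infty$. Here $U(n)$ is the group of unitary $n\times n$ complex matrices and $\|\cdot\|$ is the operator norm. A group is virtually abelian if it has an abelian subgroup of finite index. *)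

(* Defs.v *)
From HB Require Import structures.
From mathcomp Require Import all_boot all_order all_algebra.
From mathcomp Require Import spectral complex.
From mathcomp Require Import all_classical all_reals all_analysis.

Set Implicit Arguments.
Unset Strict Implicit.
Unset Printing Implicit Defensive.

Import Order.TTheory GRing.Theory Num.Theory.
Import numFieldNormedType.Exports.
Local Open Scope classical_set_scope.
Local Open Scope ring_scope.
Local Open Scope complex_scope.

HB.mixin Record Topological_isTopologicalGroup K
    of Topological K & Group K := {
  mulg_continuous : continuous (fun x : K * K => (x.1 * x.2)%g) ;
  invg_continuous : continuous (fun x : K => (x^-1)%g)
}.

#[short(type="topologicalGroupType")]
HB.structure Definition TopologicalGroup :=
  {K of Topological K & Group K & Topological_isTopologicalGroup K}.

(* A subgroup of a possibly infinite group is a [groupClosed G]; since boolean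
   predicates are arbitrary classically, this covers every subgroup. *)
Section DiscreteGroups.
Variable G : groupType.

Definition finitely_generated : Prop :=
  exists s : seq G, forall H : groupClosed G,
    {subset s <= H} -> forall x : G, x \in H.

Definition left_coset (H : groupClosed G) (x : G) : set G :=
  [set (x * h)%g | h in [set` H]].

Definition finite_index (H : groupClosed G) : Prop :=
  finite_set (range (left_coset H)).

Definition virtually_abelian : Prop :=
  exists H : groupClosed G,
    {in H &, forall x y : G, commute x y} /\ finite_index H.

End DiscreteGroups.

Arguments finitely_generated : clear implicits.
Arguments virtually_abelian : clear implicits.

Section UnitaryGroup.
Variables (R : realType) (n : nat).

Record unitary_group := UnitaryGroup {
  unitary_val :> 'M[R[i]]_n ;
  _ : unitary_val \is unitarymx
}.

HB.instance Definition _ := [isSub for unitary_val].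
HB.instance Definition _ := [Choice of unitary_group by <:].

Lemma unitary1_subproof : (1%:M : 'M[R[i]]_n) \is unitarymx.
Proof. by apply/unitarymxP; rewrite mul1mx trmx1 map_mx1. Qed.

Lemma unitaryM_subproof (A B : unitary_group) :
  (A : 'M[R[i]]_n) *m B \is unitarymx.
Proof. exact: mul_unitarymx (valP A) (valP B). Qed.

Lemma unitaryV_subproof (A : unitary_group) :
  map_mx Num.conj (A : 'M[R[i]]_n)^T \is unitarymx.
Proof. by rewrite trmxC_unitary; exact: (valP A). Qed.

Definition unitary_one := UnitaryGroup unitary1_subproof.
Definition unitary_mul A B := UnitaryGroup (unitaryM_subproof A B).
Definition unitary_inv A := UnitaryGroup (unitaryV_subproof A).

Lemma unitary_mulA : associative unitary_mul.
Proof. by move=> A B C; apply: val_inj; exact: mulmxA. Qed.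

Lemma unitary_mul1 : left_id unitary_one unitary_mul.
Proof. by move=> A; apply: val_inj; exact: mul1mx. Qed.

Lemma unitary_mulr1 : right_id unitary_one unitary_mul.
Proof. by move=> A; apply: val_inj; exact: mulmx1. Qed.

Lemma unitary_mulrV : right_inverse unitary_one unitary_inv unitary_mul.
Proof. by move=> A; apply: val_inj; exact/unitarymxP/(valP A). Qed.

Lemma unitary_mulV : left_inverse unitary_one unitary_inv unitary_mul.
Proof.
by move=> A; apply: val_inj; apply: mulmx1C; exact/unitarymxP/(valP A).
Qed.

HB.instance Definition _ := isGroup.Build unitary_group
  unitary_mulA unitary_mul1 unitary_mulr1 unitary_mulV unitary_mulrV.

End UnitaryGroup.

Definition l2norm (R : realType) (n : nat) (v : 'cV[R[i]]_n) : R :=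
  Num.sqrt (\sum_(j < n) ComplexField.Normc.normc (v j 0) ^+ 2).

(* The set below is nonempty and bounded, so [sup], which is 0 on sets without a
   supremum, is the true supremum here; likewise for the supremum over unitary
   representations below, which contains the trivial one and is bounded by 2. *)
Definition opnorm (R : realType) (n : nat) (A : 'M[R[i]]_n) : R :=
  sup [set l2norm (A *m v) | v in [set v : 'cV[R[i]]_n | l2norm v <= 1]].

Definition bohr_convergent (G : groupType) (g : nat -> G) : Prop :=
  forall K : topologicalGroupType, compact [set: K] -> hausdorff_space K ->
  forall pi : UMagmaMorphism.type G K,
    (fun k => pi (g k)) @ \oo --> (1%g : K).

Definition strongly_bohr_convergent (R : realType) (G : groupType)
    (g : nat -> G) : Prop :=
  bohr_convergent g /\
  forall n : nat,
    (fun k => sup [set opnorm (1%:M - (pi (g k) : 'M[R[i]]_n))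
                  | pi in [set: UMagmaMorphism.type G (unitary_group R n)]])
      @ \oo --> (0 : R).

(* Main.v *)
Require Import Defs.
From HB Require Import structures.
From mathcomp Require Import all_boot all_order all_algebra.
From mathcomp Require Import spectral complex.
From mathcomp Require Import all_classical all_reals all_analysis.
From mathcomp Require Import lra ring zify.

Set Implicit Arguments.
Unset Strict Implicit.
Unset Printing Implicit Defensive.

Import Order.TTheory GRing.Theory Num.Theory.
Import numFieldNormedType.Exports.
Local Open Scope classical_set_scope.
Local Open Scope ring_scope.

(** Suppose that [G] has an abelian subgroup of finite index. It then has a
    finitely generated one, [H], of some index [n]. A non-trivial element [g] of
    [H] is moved by a character of [H] ([character_separates]), and a suitable
    power of that character moves it by at least [1 / 2]. The representation of
    [G] induced from this power has dimension [n], and its diagonal coefficient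
    at the coset [H] shows that [1 - pi g] has norm at least [1 / 2]; the same
    coefficient works for [g] outside [H], where it vanishes. As [n] does not
    depend on [g], no sequence of non-trivial elements is strongly Bohr
    convergent.

    For the converse, let [pi] be a unitary representation and [T] a symmetric
    operator commuting with it, and put [l M g = |(1 - pi g) T^M|]. Expanding a
    commutator gives [l (M + M') [~ g, h] <= 2 * l M g * l M' h], and the
    Cauchy-Schwarz inequality gives [l M g ^ 2 <= B * l (2 M) g]. Such families,
    normalised so that [G] splits into [N] cells on which [l 1 (x^-1 y) <= 1],
    are called length towers below. The heart of the proof is that, unless [G]
    is virtually abelian, for every [N] some [g <> 1] satisfies
    [l 1 g <= 3 * B] for all length towers with [N] cells simultaneously
    ([small_virtually_abelian]). Taking such a [g] for [N = 0, 1, 2, ...] yields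
    the sequence. Indeed unitary representations of a fixed dimension, with [T]
    a large scalar, form towers with a common number of cells ([unitary_tower]).
    For a homomorphism to a compact group the Hilbert space consists of the
    almost periodic functions on [G] with their invariant mean, and [T] is the
    convolution by a bump function: a small [l 1 g] then puts the image of [g]
    close to the identity ([compact_tower]). This takes the place of the
    Peter-Weyl theorem, as no spectral decomposition of [T] is needed.

    To prove the central claim, assume that only [1] is small in all towers with
    [N] cells. First, there are finitely many finite sets, each generating a
    subgroup of finite index, such that every tower is at most [1] on one of
    them ([tower_types]). Consider iterated commutators whose entries run through
    these sets in blocks, each block at least twice as long as all later ones together.
    In a tower belonging to the block of length [m = 2 ^ r], the value at level
    [m] is at most [2 ^ m * B] after that block and grows by at most
    [2 ^ (m / 2)] afterwards; extracting an [m]-th root brings the value at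
    level [1] below [3 * B]. So these commutators are trivial, which makes a
    subgroup of finite index nilpotent ([small_nilpotent]). Secondly, if
    [z = [~ x, y]] commutes with [x] and [y], then [l 1 (y ^+ j) <= 1] for some
    [j] between [1] and [N], and [z ^+ (j * k) = [~ x ^+ k, y ^+ j]] is small
    for all [k]; hence [z ^+ N`! = 1] ([small_torsion]). In a finitely generated
    nilpotent group this makes the centralizer of the second center a subgroup
    of finite index, of smaller nilpotency class, and induction on the class
    ends with an abelian subgroup of finite index ([nilpotent_descent]). *)

(** * Subgroups, finite index and words *)

Ltac group_simp := by rewrite ?commgEl ?conjgE ?(invgM, invgK) ?mulgA;
  rewrite ?(mulgK, mulgVK, mulgV, mulVg, mul1g, mulg1).

Section Subgroups.
Variable G : groupType.
Local Open Scope group_scope.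
Implicit Types (H K : set G) (x y g : G) (S : seq G).

Definition subgrp H : Prop :=
  [/\ H 1, forall x y, H x -> H y -> H (x * y) & forall x, H x -> H x^-1].

Definition generated (A : set G) : set G :=
  [set x | forall H, subgrp H -> A `<=` H -> H x].

(** Finiteness of the set of left cosets, given by a finite list that meets
    every coset; this form transports easily along inclusions, intersections and
    conjugations. *)
Definition fin_idx H : Prop :=
  exists s : seq G, forall x, exists2 w, w \in s & H (w^-1 * x).

Definition wprod w : G := foldr (fun a b => a * b) 1 w.

Fixpoint word_ball S n : seq G :=
  if n is n'.+1 then word_ball S n' ++ [seq s * x | s <- S, x <- word_ball S n'] else [:: 1].

(** The upper central series relative to [H]: an element lies in the [k]-th
    term when all commutators [[~ x_k, [~ ..., [~ x_1, y]]]] with entries in [H]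
    are trivial. For [H = setT] this is the usual series. *)
Fixpoint ucs H k : set G :=
  if k is k'.+1 then [set y | forall x, H x -> ucs H k' [~ x, y]] else [set 1].

Lemma generated_subgrp A : subgrp (generated A).
Proof.
split=> [H [] //|x y Ax Ay H sH AH|x Ax H sH AH].
  by case: (sH) => _ HM _; apply: (HM); [exact: Ax|exact: Ay].
by case: (sH) => _ _ HV; apply: (HV); exact: Ax.
Qed.

Lemma sub_generated A : A `<=` generated A.
Proof. by move=> x Ax H _; exact. Qed.

Lemma generated_min A H : subgrp H -> A `<=` H -> generated A `<=` H.
Proof. by move=> sH AH x; exact. Qed.

Lemma subgrpX H x n : subgrp H -> H x -> H (x ^+ n).
Proof.
by case=> H1 HM _ Hx; elim: n => [|n IH]; rewrite ?expg0 // expgS; exact: HM.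
Qed.

Lemma subgrpR H x y : subgrp H -> H x -> H y -> H [~ x, y].
Proof.
case=> _ HM HV Hx Hy; apply: (HM); [exact: HV|].
by apply: (HM); [exact: HV|exact: HM].
Qed.

Lemma subgrpVM H x y z : subgrp H -> H (x^-1 * y) -> H (x^-1 * z) ->
  H (y^-1 * z).
Proof.
case=> _ HM HV Hy Hz; have := HM _ _ (HV _ Hy) Hz.
by rewrite invgM invgK mulgA mulgK.
Qed.

Lemma fin_idxS H K : H `<=` K -> fin_idx H -> fin_idx K.
Proof. by move=> HK [s Hs]; exists s => x; have [w ws /HK] := Hs x; exists w. Qed.

Lemma fin_idxI H K : subgrp H -> subgrp K -> fin_idx H -> fin_idx K ->
  fin_idx (H `&` K).
Proof.
move=> sH sK [s Hs] [t Ht].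
exists [seq xget 1 [set z | H (w^-1 * z) /\ K (v^-1 * z)] | w <- s, v <- t].
move=> x; have [w ws Hw] := Hs x; have [v vt Kv] := Ht x.
exists (xget 1 [set z | H (w^-1 * z) /\ K (v^-1 * z)]).
  exact: allpairs_f.
case: xgetP => [z _ [/= Hz Kz]|/(_ x)/= []//].
by split; [exact: (subgrpVM sH Hz)|exact: (subgrpVM sK Kz)].
Qed.

Lemma fin_idxT : fin_idx [set: G].
Proof. by exists [:: 1] => x; exists 1; rewrite ?mem_head. Qed.

Lemma fin_idx_bigI (I : eqType) (s : seq I) (F : I -> set G) :
  (forall i, i \in s -> subgrp (F i)) -> (forall i, i \in s -> fin_idx (F i)) ->
  fin_idx [set x | forall i, i \in s -> F i x].
Proof.
elim: s => [|i s IH] sF fF.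
  by apply: fin_idxS fin_idxT => x _ i.
have sF' j : j \in s -> subgrp (F j) by move=> js; apply: sF; rewrite inE js orbT.
have fF' j : j \in s -> fin_idx (F j) by move=> js; apply: fF; rewrite inE js orbT.
have /fin_idxS : F i `&` [set x | forall i, i \in s -> F i x] `<=`
    [set x | forall j, j \in i :: s -> F j x].
  by move=> x [Fi Fs] j; rewrite inE => /predU1P[->//|]; exact: Fs.
apply; apply: fin_idxI; [exact/sF/mem_head| |exact/fF/mem_head|exact: IH].
split=> [j|x y Fx Fy j|x Fx j] js; have [F1 FM FV] := sF' _ js => //.
  by apply: FM; [exact: Fx|exact: Fy].
exact/FV/Fx.
Qed.

Lemma subgrpJ H g : subgrp H -> subgrp [set x | H (x ^ g)].
Proof.
case=> H1 HM HV; split=> [|x y Hx Hy|x Hx] /=.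
- by rewrite conj1g.
- by rewrite conjMg; exact: HM.
- by rewrite conjVg; exact: HV.
Qed.

Lemma fin_idxJ H g : fin_idx H -> fin_idx [set x | H (x ^ g)].
Proof.
case=> s Hs; exists [seq w ^ g^-1 | w <- s] => x.
have [w ws Hw] := Hs (x ^ g); exists (w ^ g^-1); first exact: map_f.
by rewrite /= conjMg conjVg conjgKV.
Qed.

Definition core H : set G := [set x | forall g, H (x ^ g)].

(** Conjugates of [H] by elements of one left coset of [H] agree, so the core
    is an intersection of finitely many conjugates. *)
Lemma fin_idx_core H : subgrp H -> fin_idx H -> fin_idx (core H).
Proof.
move=> sH fH; have [s Hs] := fH.
have /fin_idxS : [set x | forall w, w \in s -> H (x ^ w)] `<=` core H.
  move=> x Hx g; have [w ws Hw] := Hs g.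
  rewrite -(mulKg w^-1 g) invgK conjgM; case: (sH) => _ HM HV.
  by apply: (HM); [exact: HV|apply: (HM) => //; exact: Hx].
apply; apply: (@fin_idx_bigI _ s (fun w => [set x | H (x ^ w)])) => w _.
  exact: subgrpJ.
exact: fin_idxJ.
Qed.

Lemma core_subgrp H : subgrp H -> subgrp (core H).
Proof.
move=> sH; split=> [g|x y Hx Hy g|x Hx g]; have [H1 HM HV] := sH.
- by rewrite conj1g.
- by rewrite conjMg; exact: HM.
- by rewrite conjVg; exact: HV.
Qed.

Lemma core_normal H x g : core H x -> core H (x ^ g).
Proof. by move=> Hx h; rewrite -conjgM; exact: Hx. Qed.

Lemma core_sub H : core H `<=` H.
Proof. by move=> x /(_ 1); rewrite conjg1. Qed.

Definition sym_gens S := S ++ [seq x^-1 | x <- S].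

Lemma sym_gens_inv S x : x \in sym_gens S -> x^-1 \in sym_gens S.
Proof.
rewrite !mem_cat => /orP[xS|/mapP[y yS ->]].
  by rewrite (map_f (fun x => x^-1) xS) orbT.
by rewrite invgK yS.
Qed.

Lemma wprod_cat u v : wprod (u ++ v) = wprod u * wprod v.
Proof. by elim: u => [|a u IH] /=; rewrite ?mul1g // IH mulgA. Qed.

Lemma wprod_rev_inv u : (wprod u)^-1 = wprod (rev ([seq x^-1 | x <- u])).
Proof.
elim: u => [|a u IH] /=; first by rewrite invg1.
by rewrite invgM IH rev_cons -cats1 wprod_cat /= mulg1.
Qed.

Lemma word_ball_wprod S w n : {subset w <= S} -> (size w <= n)%N -> wprod w \in word_ball S n.
Proof.
elim: n w => [|n IH] [|a w] //= wS wn; rewrite ?mem_head //.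
  by rewrite mem_cat (IH [::]).
rewrite mem_cat (allpairs_f (fun s w => s * w)) ?orbT //.
  by apply: wS; exact: mem_head.
by apply: IH => // x xw; apply: wS; rewrite inE xw orbT.
Qed.

Lemma generated_wprod S x : generated [set` S] x -> exists2 w, {subset w <= sym_gens S} & x = wprod w.
Proof.
move=> /(_ [set x | exists2 w, {subset w <= sym_gens S} & x = wprod w]); apply; first split.
- by exists [::].
- move=> y z [u uS ->] [v vS ->]; exists (u ++ v); last by rewrite wprod_cat.
  by move=> a; rewrite mem_cat => /orP[/uS|/vS].
- move=> y [u uS ->]; exists (rev ([seq x^-1 | x <- u])); last by rewrite wprod_rev_inv.
  by move=> a; rewrite mem_rev => /mapP[b /uS bS ->]; exact: sym_gens_inv.
- move=> a /= aS; exists [:: a]; last by rewrite /= mulg1.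
  by move=> b; rewrite inE => /eqP ->; rewrite mem_cat aS.
Qed.

(** Among the suffixes of a word of length more than [N], two lie in the same
    cell, and replacing the longer one by the shorter one changes the element
    only by a factor in [D] of length at most [2 N]. So modulo the subgroup
    generated by such factors every element is a word of length at most [N]. The
    point is that the generators may be taken in a ball that does not depend on
    the cells, which leaves only finitely many possible generating sets. *)
Lemma fin_idx_pigeonhole S N (k : G -> 'I_N) (D : set G) :
  (forall x, generated [set` S] x) ->
  (forall x y, k x = k y -> D (x^-1 * y)) ->
  fin_idx (generated [set x | x \in word_ball (sym_gens S) (N + N) /\ D x]).
Proof.
move=> genS kD; set H := generated _; have sH : subgrp H by exact: generated_subgrp.
exists (word_ball (sym_gens S) N) => x; have [w] := generated_wprod (genS x).
have [l] := ubnP (size w); elim: l w x => // l IH w x; rewrite ltnS => wl wS ->.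
have [wN|Nw] := leqP (size w) N.
  exists (wprod w); first exact: word_ball_wprod.
  by rewrite mulVg; case: sH.
(* [p i] is the suffix of length [i]. *)
pose p (i : 'I_N.+1) := drop (size w - i) w.
have [i [j [ij kij]]] : exists i j : 'I_N.+1,
    (i < j)%N /\ k (wprod (p i)) = k (wprod (p j)).
  have /injectivePn[i [j ij kij]] : ~~ injectiveb (fun i => k (wprod (p i))).
    by apply/injectiveP => /leq_card; rewrite !card_ord ltnn.
  have [lij|] := ltnP i j; first by exists i, j.
  rewrite leq_eqVlt => /predU1P[/val_inj ji|lji]; last by exists j, i.
  by rewrite ji eqxx in ij.
have iw (i' : 'I_N.+1) : (i' <= size w)%N.
  by rewrite (leq_trans _ (ltnW Nw)) // -ltnS.
have sp (i' : 'I_N.+1) : size (p i') = i' by rewrite size_drop subKn.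
have pS (i' : 'I_N.+1) : {subset p i' <= sym_gens S} by move=> a /mem_drop /wS.
have Hij : H ((wprod (p i))^-1 * wprod (p j)).
  apply: sub_generated; split; last exact: kD.
  rewrite wprod_rev_inv -wprod_cat word_ball_wprod //.
    move=> a; rewrite mem_cat mem_rev => /orP[/mapP[b /pS bS ->]|/pS //].
    exact: sym_gens_inv.
  by rewrite size_cat size_rev size_map !sp leq_add // -ltnS.
have [|||b bN Hb] := IH (take (size w - j) w ++ p i) (wprod (take (size w - j) w) * wprod (p i)).
- rewrite size_cat sp size_take_min (minn_idPl (leq_subr _ _)).
  by rewrite (leq_trans _ wl)// -{2}(subnK (iw j)) ltn_add2l.
- by move=> a; rewrite mem_cat => /orP[/mem_take /wS|/pS].
- by rewrite wprod_cat.
exists b => //; rewrite -(cat_take_drop (size w - j) w) wprod_cat.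
have [_ HM _] := sH; have := HM _ _ Hb Hij.
by rewrite -!mulgA mulVKg.
Qed.

Lemma ucs_subgrp H k : (forall x g, H x -> H (x ^ g)) ->
  subgrp (ucs H k) /\ (forall y g, ucs H k y -> ucs H k (y ^ g)).
Proof.
move=> Hn; elim: k => [|k [[U1 UM UV] UJ]] /=.
  split; last by move=> y g ->; rewrite conj1g.
  by split=> [//|x y -> ->|x ->]; rewrite ?mulg1 ?invg1.
split; first split.
- by move=> x Hx; rewrite commg1.
- move=> y z Uy Uz x Hx /=.
  have -> : [~ x, y * z] = [~ x, z] * [~ x, y] ^ z.
    by group_simp.
  by apply: (UM); [exact: Uz|apply: (UJ); exact: Uy].
- move=> y Uy x Hx /=.
  have -> : [~ x, y^-1] = ([~ x, y]^-1) ^ y^-1.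
    by group_simp.
  by apply: (UJ); apply: (UV); exact: Uy.
- move=> y g Uy x Hx /=.
  have -> : [~ x, y ^ g] = [~ x ^ g^-1, y] ^ g by rewrite conjRg conjgKV.
  by apply: (UJ); apply: Uy; exact: Hn.
Qed.

(** Modulo the normal subgroup [ucs H k], the elements that commute with [y]
    form a subgroup. *)
Lemma ucs_generated H A k y : (forall x g, H x -> H (x ^ g)) ->
  (forall x, A x -> ucs H k [~ x, y]) -> forall x, generated A x -> ucs H k [~ x, y].
Proof.
move=> Hn Ay x; have [[U1 UM UV] UJ] := ucs_subgrp k Hn.
move=> /(_ [set x | ucs H k [~ x, y]]); apply=> //; split=> [|a b Ua Ub|a Ua] /=.
- by rewrite comm1g.
- have -> : [~ a * b, y] = [~ a, y] ^ b * [~ b, y].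
    by group_simp.
  by apply: (UM) => //; exact: UJ.
- have -> : [~ a^-1, y] = ([~ a, y]^-1) ^ a^-1.
    by group_simp.
  by apply: (UJ); exact: UV.
Qed.

Lemma ucsS H K k : K `<=` H -> ucs H k `<=` ucs K k.
Proof.
by move=> KH; elim: k => [|k IH] y //= Hy x /KH Hx; apply: IH; exact: Hy.
Qed.

End Subgroups.

(** * Nilpotent groups whose central commutators have bounded exponent *)

Section BoundedExponent.
Variable G : groupType.
Local Open Scope group_scope.
Implicit Types (A : seq G) (H K : set G) (x y w : G).

Fixpoint monomials E A : seq G :=
  if A is a :: A' then [seq a ^+ i * w | i <- iota 0 E, w <- monomials E A']
  else [:: 1].

Lemma monomials_sub E A H w :
  subgrp H -> [set` A] `<=` H -> w \in monomials E A -> H w.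
Proof.
move=> sH; have [H1 HM _] := sH.
elim: A w => [|a A IH] w AH /=; first by rewrite inE => /eqP->.
move=> /allpairsP[[i v] /= [_ vA ->]]; apply: (HM).
  by apply: subgrpX => //; apply: AH; exact: mem_head.
by apply: IH vA => x xA; apply: AH; rewrite /= inE xA orbT.
Qed.

Section Cofinite.
Variables (E : nat) (H K : set G).
Hypotheses (E0 : (0 < E)%N) (sH : subgrp H) (sK : subgrp K).
Hypothesis KE : forall x, H x -> K (x ^+ E).
Hypothesis KR : forall x y, H x -> H y -> K [~ x, y].
Hypothesis KH : K `<=` H.

(** Here [K] contains all commutators of [H], so [K] is normal in [H]. *)
Lemma cofinite_normal x g : K x -> H g -> K (x ^ g).
Proof.
move=> Kx Hg; rewrite -(mulVKg x (x ^ g)) -commgEl.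
by have [_ KM _] := sK; apply: KM => //; apply: KR => //; exact: KH.
Qed.

(** Modulo [K] the generators commute and have exponent [E], so the exponent
    of [s] can be increased inside a monomial and reduced modulo [E]. *)
Lemma monomialsM A s w : [set` A] `<=` H -> s \in A -> w \in monomials E A ->
  exists2 v, v \in monomials E A & K (v^-1 * (s * w)).
Proof.
have [K1 KM KV] := sK; have [H1 HM HV] := sH.
elim: A s w => [//|a A IH] s w AH /=.
have AH' : [set` A] `<=` H by move=> x xA; apply: AH; rewrite /= inE xA orbT.
have Ha : H a by apply: AH; exact: mem_head.
rewrite inE => sA /allpairsP[[i v] /= []]; rewrite mem_iota add0n => iE vA ->.
have Hv : H v by exact: monomials_sub vA.
have [->|/eqP sa] := eqVneq s a.
  rewrite mulgA -expgS; have [iE'|] := ltnP i.+1 E.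
    exists (a ^+ i.+1 * v); last by rewrite mulVg.
    by apply: (allpairs_f (fun i w => a ^+ i * w)) => //; rewrite mem_iota.
  move=> Ei; have <- : E = i.+1 by apply/eqP; rewrite eqn_leq Ei.
  exists (a ^+ 0 * v).
    by apply: (allpairs_f (fun i w => a ^+ i * w)) => //; rewrite mem_iota.
  by rewrite expg0 mul1g -conjgE; apply: cofinite_normal => //; exact: KE.
have {}sA : s \in A by case/predU1P: sA.
have Hs : H s by exact: AH'.
have [u uA Ku] := IH s v AH' sA vA.
exists (a ^+ i * u).
  by apply: (allpairs_f (fun i w => a ^+ i * w)) => //; rewrite mem_iota.
have -> : (a ^+ i * u)^-1 * (s * (a ^+ i * v)) =
    (u^-1 * (s * v)) * [~ s, a ^+ i] ^ v.
  by group_simp.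
by apply: (KM) => //; apply: cofinite_normal => //; apply: KR => //; exact: subgrpX.
Qed.

Lemma monomialsXM A s w n : [set` A] `<=` H -> s \in A -> w \in monomials E A ->
  exists2 v, v \in monomials E A & K (v^-1 * (s ^+ n * w)).
Proof.
have [K1 KM KV] := sK; have [H1 HM HV] := sH.
move=> AH sA; have Hs : H s by exact: AH.
elim: n w => [|n IH] w wA; first by exists w; rewrite // expg0 mul1g mulVg.
have [u uA Ku] := IH _ wA; have [v vA Kv] := monomialsM AH sA uA.
exists v => //; rewrite expgS.
have -> : v^-1 * (s * s ^+ n * w) = (v^-1 * (s * u)) * (u^-1 * (s ^+ n * w)).
  by group_simp.
exact: KM.
Qed.

Lemma monomials_cover A x : [set` A] `<=` H -> generated [set` A] x ->
  exists2 v, v \in monomials E A & K (v^-1 * x).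
Proof.
have [K1 KM KV] := sK; have [H1 HM HV] := sH.
move=> AH /generated_wprod[w]; elim: w x => [|s w IH] x wA ->.
  exists 1; last by rewrite invg1 mul1g.
  elim: A {AH wA} => [|a A IH] //=; first exact: mem_head.
  rewrite -[1](mul1g 1) -[X in X * _](expg0 a).
  by apply: (allpairs_f (fun i w => a ^+ i * w)) => //; rewrite mem_iota.
have [|u uA Ku] := IH (wprod w) _ erefl.
  by move=> y yw; apply: wA; rewrite inE yw orbT.
have := wA s (mem_head _ _); rewrite mem_cat => /orP[sA|/mapP[a aA sa]] /=.
  have [v vA Kv] := monomialsM AH sA uA; exists v => //.
  have -> : v^-1 * (s * wprod w) = (v^-1 * (s * u)) * (u^-1 * wprod w) by group_simp.
  exact: KM.
have Ha : H a by exact: AH.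
have [v vA Kv] := monomialsXM E.-1 AH aA uA; exists v => //.
have Hu : H u by exact: monomials_sub uA.
have -> : v^-1 * (s * wprod w) =
   (v^-1 * (a ^+ E.-1 * u)) * ((a ^+ E)^-1) ^ u * (u^-1 * wprod w).
  rewrite sa -{2}(prednK E0) expgS; by group_simp.
apply: (KM) => //; apply: (KM) => //; apply: cofinite_normal => //.
by apply: (KV); exact: KE.
Qed.

(** A finitely generated abelian group of bounded exponent is finite; this is
    applied to the quotient of [H] by [K]. *)
Lemma fin_idx_cofinite A : [set` A] `<=` H -> fin_idx (generated [set` A]) -> fin_idx K.
Proof.
move=> AH [s Hs]; exists [seq v * w | v <- s, w <- monomials E A] => x.
have [v vs /(monomials_cover AH)[w wA Kw]] := Hs x.
exists (v * w); first exact: (allpairs_f (fun v w => v * w)).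
by rewrite invgM -mulgA.
Qed.

End Cofinite.

(** A subgroup of finite index in a finitely generated group contains a
    finitely generated one of finite index. This weak form of the theorem of
    Schreier follows from the pigeonhole lemma applied to the cosets of [H]. *)
Lemma fin_idx_fg (S : seq G) H : (forall x, generated [set` S] x) -> subgrp H -> fin_idx H ->
  exists2 A : seq G, [set` A] `<=` H & fin_idx (generated [set` A]).
Proof.
move=> genS sH [s Hs].
have rep x : exists i : 'I_(size s), H ((nth 1 s i)^-1 * x).
  have [w ws Hw] := Hs x; have lt_i : (index w s < size s)%N by rewrite index_mem.
  by exists (Ordinal lt_i); rewrite nth_index.
pose k x := sval (cid (rep x)).
have kP x : H ((nth 1 s (k x))^-1 * x) by rewrite /k; case: cid.
have kD x y : k x = k y -> H (x^-1 * y).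
  by move=> kxy; apply: (subgrpVM sH (kP x)); rewrite kxy.
have := fin_idx_pigeonhole genS kD.
set b := word_ball _ _ => fH.
exists [seq x <- b | `[< H x >]].
  by move=> x /=; rewrite mem_filter => /andP[/asboolP].
apply: fin_idxS fH => x gx K sK AK; apply: gx => // y [yb Hy].
by apply: AK; rewrite /= mem_filter yb andbT; exact/asboolP.
Qed.

End BoundedExponent.

(** For [y] in the second center of [H], the map [x |-> [~ x, y]] is a
    homomorphism to the center whose values have exponent [E]. Hence the
    centralizer of the second center contains all [E]-th powers and all
    commutators, has finite index, and has smaller class than [H]. *)
Lemma nilpotent_descent (G : groupType) (S : seq G) E c (H : set G) :
  (0 < E)%N -> (forall x, generated [set` S] x) ->
  (forall x y : G, commute [~ x, y]%g x -> commute [~ x, y]%g y ->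
     ([~ x, y] ^+ E = 1)%g) ->
  subgrp H -> fin_idx H -> (forall y, H y -> ucs H c y) ->
  exists K : set G, [/\ subgrp K, fin_idx K &
    forall x y, K x -> K y -> commute x y].
Proof.
move=> E0 genS tors; elim: c H => [|c IH] H sH fH Hc.
  by exists H; split=> // x y /Hc /= -> /Hc /= ->.
have [c0|c_gt0] := posnP c.
  exists H; split=> // x y Hx /Hc; rewrite c0 => /(_ _ Hx) /= /eqP /commgP //.
case: c c_gt0 IH Hc => // c _ IH Hc.
have [A AH fA] := fin_idx_fg genS sH fH.
set L := generated [set` A] in fA.
have sL : subgrp L by exact: generated_subgrp.
have LH : L `<=` H by exact: generated_min.
have {}Hc y : L y -> ucs L c.+2 y by move=> /LH /Hc; exact: ucsS.
have [L1 LM LV] := sL.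
pose Z2 := [set y | L y /\ ucs L 2 y].
have Z2P y : Z2 y -> forall x x', L x -> L x' -> commute x' [~ x, y]%g.
  by move=> [_ Zy] x x' Lx Lx'; apply/commgP/eqP; exact: Zy.
have Z2M y : Z2 y -> forall x x', L x -> L x' ->
    [~ x * x', y]%g = ([~ x, y] * [~ x', y])%g.
  move=> Zy x x' Lx Lx'.
  have -> : [~ x * x', y]%g = ([~ x, y] ^ x' * [~ x', y])%g by group_simp.
  congr (_ * _)%g; apply/conjg_fixP; rewrite commg1_sym; apply/commgP.
  exact: Z2P.
have Z2X y : Z2 y -> forall x n, L x -> ([~ x ^+ n, y] = [~ x, y] ^+ n)%g.
  move=> Zy x n Lx; elim: n => [|n IHn]; first by rewrite !expg0 comm1g.
  by rewrite !expgS Z2M // ?IHn //; exact: (subgrpX n sL Lx).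
have Z2V y : Z2 y -> forall x, L x -> [~ x, y]%g = 1%g -> [~ x^-1, y]%g = 1%g.
  move=> Zy x Lx xy; have := Z2M y Zy x x^-1%g Lx (LV _ Lx).
  by rewrite mulgV comm1g xy mul1g.
pose K := [set x | L x /\ forall y, Z2 y -> [~ x, y]%g = 1%g].
have sK : subgrp K.
  split=> [|x x' [Lx Kx] [Lx' Kx']|x [Lx Kx]].
  - by split=> // y _; rewrite comm1g.
  - split; first exact: LM.
    by move=> y Zy; rewrite Z2M // Kx // Kx' // mulg1.
  - split; first exact: LV.
    by move=> y Zy; exact: (Z2V y Zy x Lx (Kx y Zy)).
have fK : fin_idx K.
  apply: (fin_idx_cofinite E0 sL sK) fA => // [x Lx|x x' Lx Lx'|x []//|].
  - split; first exact: (subgrpX E sL Lx).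
    move=> y Zy; rewrite Z2X // tors //.
      exact/commute_sym/(Z2P y Zy x x Lx Lx).
    exact/commute_sym/(Z2P y Zy x y Lx (proj1 Zy)).
  - split; first exact: (subgrpR sL Lx Lx').
    move=> y Zy; rewrite (commgEl x x') conjgE.
    have [LVx LVx' LM'] := And3 (LV _ Lx) (LV _ Lx') (LM _ _ Lx Lx').
    rewrite !Z2M //; last exact: LM.
    have VE z : L z -> [~ z^-1, y]%g = ([~ z, y]^-1)%g.
      move=> Lz; apply/esym/mulg1_eq.
      by rewrite -Z2M // ?mulgV ?comm1g //; exact: LV.
    rewrite !VE //.
    have cxy : commute [~ x', y]%g [~ x, y]%g.
      exact: (Z2P y Zy x _ Lx (subgrpR sL Lx' (proj1 Zy))).
    by rewrite -(cxy : (_ * _ = _ * _)%g) mulKg mulVg.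
  - exact: sub_generated.
apply: (IH K sK fK) => y Ky.
have Ly : L y by case: Ky.
have {Ky}: ucs L c.+2 y by exact: Hc.
elim: c {IH Hc} y Ly => [|c IHc] y Ly Uy.
  by move=> x [_ Kx] /=; apply: Kx.
move=> x [Lx Kx]; apply: IHc; first exact: (subgrpR sL Lx Ly).
exact: Uy.
Qed.

(** * Length towers *)

(** The model is [l M g = |(1 - pi g) T^M|] for a unitary representation [pi]
    and a symmetric operator [T] commuting with it. The operator is scaled so
    that [l 1 <= 1] defines the neighbourhood of the identity to which the
    pigeonhole principle is applied, and [l 0], the displacement without
    smoothing, is at most [B]. *)
Record length_tower (R : realType) (G : groupType) (N : nat) (B : R)
    (l : nat -> G -> R) : Prop := LengthTower {
  tower_ge1 : 1 <= B;
  tower_ge0 : forall M g, 0 <= l M g;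
  tower_le : forall g, l 0 g <= B;
  towerV : forall M g, l M g^-1%g <= l M g;
  towerM : forall M g h, l M (g * h)%g <= l M g + l M h;
  towerJ : forall M g h, l M (g ^ h)%g <= l M g;
  towerR : forall M M' g h, l (M + M')%N [~ g, h]%g <= 2 * l M g * l M' h;
  tower_root : forall M g, l M g ^+ 2 <= B * l (M + M)%N g;
  tower_cells : exists k : G -> 'I_N,
    forall x y, k x = k y -> l 1 (x^-1 * y)%g <= 1
}.

Definition iter_comm (G : groupType) (xs : seq G) (y : G) : G :=
  foldl (fun y x => [~ x, y]%g) y xs.

Lemma commgX_central (G : groupType) (x y : G) n :
  commute [~ x, y]%g y -> [~ x, y ^+ n]%g = ([~ x, y] ^+ n)%g.
Proof.
move=> zy; elim: n => [|n IH]; first by rewrite !expg0 commg1.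
rewrite expgS (_ : [~ x, y * _]%g = ([~ x, y ^+ n] * [~ x, y] ^ (y ^+ n))%g).
  rewrite IH expgSr; congr (_ * _)%g; apply/conjg_fixP/commgP/commuteX.
  exact: zy.
by group_simp.
Qed.

Lemma commXg_central (G : groupType) (x y : G) n :
  commute [~ x, y]%g x -> [~ x ^+ n, y]%g = ([~ x, y] ^+ n)%g.
Proof.
move=> zx; rewrite -[LHS]invgK invgR commgX_central -?expVgn ?invgR //.
by rewrite -invgR; apply/commute_sym/commuteV/commute_sym.
Qed.

Section Tower.
Variables (R : realType) (G : groupType) (N : nat) (B : R) (l : nat -> G -> R).
Hypothesis lT : length_tower N B l.

Lemma tower_gt0 : 0 < B.
Proof. exact: lt_le_trans ltr01 (tower_ge1 lT). Qed.

(** The model case is [|X T|^m <= |X|^(m - 1) |X T^m|] for commuting normal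
    operators, obtained by iterated doubling. It turns bounds at a high level
    into bounds at level [1] in which constant factors disappear. *)
Lemma tower_root_iter r g : l 1 g ^+ (2 ^ r) * B <= B ^+ (2 ^ r) * l (2 ^ r)%N g.
Proof.
have B0 := tower_gt0; elim: r => [|r IH]; first by rewrite expn0 !expr1 mulrC.
have IH2 : (l 1 g ^+ (2 ^ r) * B) ^+ 2 <= (B ^+ (2 ^ r) * l (2 ^ r)%N g) ^+ 2.
  by rewrite ler_pXn2r // nnegrE ?mulr_ge0 ?exprn_ge0 ?(tower_ge0 lT) // ltW.
have := le_trans IH2 _; rewrite !exprMn -!exprM -[(2 ^ r * 2)%N]expnSr.
move=> /(_ (B ^+ (2 ^ r.+1) * (B * l (2 ^ r.+1)%N g))) IH3.
rewrite -(ler_pM2r B0) -mulrA -expr2 (le_trans (IH3 _)) //.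
  rewrite ler_pM2l ?exprn_gt0 //.
  by have := tower_root lT (2 ^ r)%N g; rewrite addnn -mul2n -expnS.
by rewrite -mulrA (mulrC B).
Qed.

(** The [2 ^ r]-th root of the assumed bound is [2 * B] times a factor that
    does not exceed [3 / 2]. *)
Lemma tower_small r q g : l (2 ^ r)%N g <= q * 2 ^+ (2 ^ r) * B ->
  q <= (3 / 2) ^+ (2 ^ r) -> l 1 g <= 3 * B.
Proof.
move=> lq q32; have B0 := tower_gt0.
have : l 1 g ^+ (2 ^ r) <= (3 * B) ^+ (2 ^ r).
  rewrite -(ler_pM2r B0) (le_trans (tower_root_iter r g)) //.
  rewrite exprMn mulrAC [leRHS]mulrC ler_pM2l ?exprn_gt0 //.
  rewrite (le_trans lq) // ler_pM2r // (_ : 3 = 3 / 2 * 2); last by lra.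
  by rewrite exprMn ler_pM2r // exprn_gt0.
by rewrite ler_pXn2r ?expn_gt0 // nnegrE ?(tower_ge0 lT) // mulr_ge0 // ltW.
Qed.

(** The commutator is a conjugate of [y^-1] times [y]. *)
Lemma tower_comm_le M x y : l M [~ x, y]%g <= 2 * l M y.
Proof.
rewrite commgEr (le_trans (towerM lT _ _ _)) // mulr_natl mulr2n lerD2r.
by rewrite (le_trans (towerJ lT _ _ _)) // (towerV lT).
Qed.

Lemma tower_iter_comm_le M xs y : l M (iter_comm xs y) <= 2 ^+ size xs * l M y.
Proof.
elim: xs y => [|x xs IH] y /=; first by rewrite mul1r.
rewrite (le_trans (IH _)) // exprSr -mulrA ler_wpM2l ?exprn_ge0 //.
exact: tower_comm_le.
Qed.

(** Each entry of length at most [1] costs a factor [2] and raises the level by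
    [1]. *)
Lemma tower_iter_comm_near M xs y : (forall x, x \in xs -> l 1 x <= 1) ->
  l (size xs + M)%N (iter_comm xs y) <= 2 ^+ size xs * l M y.
Proof.
elim: xs M y => [|x xs IH] M y lx /=; first by rewrite mul1r.
rewrite addSnnS (le_trans (IH _ _ _)) //.
  by move=> z zxs; apply: lx; rewrite inE zxs orbT.
rewrite exprSr -mulrA ler_wpM2l ?exprn_ge0 // -add1n.
rewrite (le_trans (towerR lT _ _ _ _)) // ler_wpM2r ?(tower_ge0 lT) //.
by rewrite ger_pMr // lx // mem_head.
Qed.

Lemma iter_comm_cat (xs ys : seq G) y :
  iter_comm (xs ++ ys) y = iter_comm ys (iter_comm xs y).
Proof. exact: foldl_cat. Qed.

(** Only the entries in [ys] are known to be short in this tower. They raise the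
    level to [2 ^ r]; the later entries [zs] multiply the bound by at most
    [2 ^ size zs], which the root at level [2 ^ r] absorbs because there are
    at most half as many of them. *)
Lemma tower_block_small r (xs ys zs : seq G) y : size ys = (2 ^ r)%N ->
  (forall x, x \in ys -> l 1 x <= 1) -> (2 * size zs <= 2 ^ r)%N ->
  l 1 (iter_comm (xs ++ ys ++ zs) y) <= 3 * B.
Proof.
move=> sys lys szs; rewrite !iter_comm_cat; set u := iter_comm xs y.
apply: (@tower_small r (2 ^+ size zs)).
  rewrite (le_trans (tower_iter_comm_le _ _ _)) // -mulrA.
  rewrite ler_wpM2l ?exprn_ge0 //.
  have := tower_iter_comm_near 0 u lys; rewrite addn0 sys => /le_trans; apply.
  by rewrite ler_wpM2l ?exprn_ge0 // (tower_le lT).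
apply: (@le_trans _ _ ((3 / 2) ^+ (2 * size zs))).
  by rewrite exprM lerXn2r // ?nnegrE; [lra|lra|rewrite expr2; lra].
by rewrite ler_weXn2l //; lra.
Qed.

(** All powers of [[~ x, y ^+ n]] are commutators of [y ^+ n], so they are all
    at most [2]. *)
Lemma tower_central_powers x y n : commute [~ x, y]%g x -> commute [~ x, y]%g y ->
  l 1 (y ^+ n)%g <= 1 -> forall k, l 1 ([~ x, y] ^+ (n * k))%g <= 3 * B.
Proof.
move=> zx zy ly; set Y := (y ^+ n)%g in ly.
move=> k; rewrite expgnA -commgX_central // -commXg_central.
  rewrite (le_trans (tower_comm_le _ _ _)) //.
  by have := tower_ge1 lT; rewrite -/Y; lra.
by rewrite commgX_central //; apply/commute_sym/commuteX/commute_sym.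
Qed.
End Tower.

(** * Elements that are small in every tower *)

(** Each block is at least twice as long as all later blocks together, and its
    length is a power of two so that a root can be extracted by repeated squaring. *)
Fixpoint blocks (T : Type) (s : seq T) : seq T :=
  if s is A :: s' then nseq (2 ^ (2 * size s')) A ++ blocks s' else [::].

Lemma size_blocks (T : Type) (s : seq T) : (2 * size (blocks s) <= 2 ^ (2 * size s))%N.
Proof.
elim: s => [//|A s IH] /=; rewrite size_cat size_nseq mulnDr.
by rewrite mulnS expnD; lia.
Qed.

Lemma blocks_split (T : eqType) (s : seq T) A : A \in s -> exists L1 L2 r,
  blocks s = L1 ++ nseq (2 ^ r) A ++ L2 /\ (2 * size L2 <= 2 ^ r)%N.
Proof.
elim: s => [//|A' s IH]; rewrite inE => /predU1P[->|/IH[L1 [L2 [r [e s2]]]]] /=.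
  by exists [::], (blocks s), (2 * size s)%N; split=> //; exact: size_blocks.
by exists (nseq (2 ^ (2 * size s)) A' ++ L1), L2, r; rewrite e -!catA.
Qed.

Lemma blocks_mem (T : eqType) (s : seq T) A : A \in blocks s -> A \in s.
Proof.
elim: s => [//|B s IH] /=; rewrite mem_cat inE => /orP[|/IH->]; last by rewrite orbT.
by rewrite mem_nseq => /andP[_ ->].
Qed.

Lemma all2_cat_split (S T : Type) (r : S -> T -> bool) xs L1 L2 :
  all2 r xs (L1 ++ L2) -> exists x1 x2,
  [/\ xs = x1 ++ x2, all2 r x1 L1 & all2 r x2 L2].
Proof.
elim: L1 xs => [|A L1 IH] xs /=; first by exists [::], xs.
case: xs => [//|x xs] /= /andP[rx /IH[x1 [x2 [-> r1 r2]]]].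
by exists (x :: x1), x2; rewrite /= rx.
Qed.

Lemma all2_size (S T : Type) (r : S -> T -> bool) xs L : all2 r xs L -> size xs = size L.
Proof. by elim: L xs => [|A L IH] [|x xs] //= /andP[_ /IH->]. Qed.

Lemma all2_nseqr (S : eqType) (T : Type) (r : S -> T -> bool) xs n A :
  all2 r xs (nseq n A) -> forall x, x \in xs -> r x A.
Proof.
elim: n xs => [|n IH] [|x xs] //= /andP[rx /IH rxs] y.
by rewrite inE => /predU1P[->//|/rxs].
Qed.

Section Main.
Variables (R : realType) (G : groupType) (S : seq G) (N : nat).
Hypothesis genS : forall x, generated [set` S] x.

Lemma ucs_blocks (H : set G) (L : seq (seq G)) y :
  (forall x g, H x -> H (x ^ g)%g) -> (forall A, A \in L -> H `<=` generated [set` A]) ->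
  (forall xs, all2 (fun x (A : seq G) => x \in A) xs L -> iter_comm xs y = 1%g) ->
  ucs H (size L) y.
Proof.
move=> Hn; elim: L y => [|A L IH] y HL y1 /=; first exact: (y1 [::]).
move=> x Hx; apply: (@ucs_generated _ H [set` A]) => //.
  move=> a /= aA; apply: IH => [B BL|xs xsL].
    by apply: HL; rewrite inE BL orbT.
  by apply: (y1 (a :: xs)); rewrite /= aA.
by apply: HL Hx; exact: mem_head.
Qed.

(** The types are subsets of one ball in the Cayley graph; their list does not
    depend on the tower, although the set of short elements does. *)
Lemma tower_types : exists2 Ts : seq (seq G),
  (forall A, A \in Ts -> fin_idx (generated [set` A])) &
  forall B (l : nat -> G -> R), length_tower N B l ->
    exists2 A, A \in Ts & forall x, x \in A -> l 1%N x <= 1.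
Proof.
pose b := word_ball (sym_gens S) (N + N).
pose subs := [seq mask (tval m) b | m <- enum {: (size b).-tuple bool}].
exists [seq A <- subs | `[< fin_idx (generated [set` A]) >]].
  by move=> A; rewrite mem_filter => /andP[/asboolP].
move=> B l lT; have [k kl] := tower_cells lT.
pose A := [seq x <- b | l 1%N x <= 1]; exists A; last first.
  by move=> x; rewrite mem_filter => /andP[].
rewrite mem_filter; apply/andP; split.
  apply/asboolP; have := fin_idx_pigeonhole genS (D := [set x | l 1%N x <= 1]) kl.
  apply: fin_idxS => x gx K sK AK; apply: gx => // y [yb ly].
  by apply: AK; rewrite /= mem_filter yb andbT.
have sm : size [seq l 1%N x <= 1 | x <- b] == size b by rewrite size_map.
apply/mapP; exists (Tuple sm); first by rewrite mem_enum.
by rewrite /= /A filter_mask.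
Qed.

Hypothesis small1 : forall g : G,
  (forall B (l : nat -> G -> R), length_tower N B l -> l 1%N g <= 3 * B) -> g = 1%g.

(** Every tower is short on the type of one of the blocks, so the iterated
    commutators along all blocks are small in every tower, hence trivial. A
    normal subgroup of finite index inside all subgroups generated by the types
    is therefore nilpotent, of class at most the total length of the blocks. *)
Lemma small_nilpotent : exists (H : set G) c,
  [/\ subgrp H, fin_idx H & forall y, ucs H c y].
Proof.
have [Ts fTs TsP] := tower_types.
pose K := [set x | forall A, A \in Ts -> generated [set` A] x].
have sK : subgrp K.
  split=> [A _|x y Kx Ky A ATs|x Kx A ATs]; have [H1 HM HV] := generated_subgrp [set` A].
  - exact: H1.
  - exact: HM (Kx _ ATs) (Ky _ ATs).
  - exact: HV (Kx _ ATs).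
have fK : fin_idx K.
  apply: (@fin_idx_bigI _ _ Ts (fun A : seq G => generated [set` A])) => A ATs.
    exact: generated_subgrp.
  exact: fTs.
exists (core K), (size (blocks Ts)); split=> [||y].
- exact: core_subgrp.
- exact: fin_idx_core.
apply: ucs_blocks => [x g|A /blocks_mem ATs x /core_sub|xs xsL].
- exact: core_normal.
- exact.
apply: small1 => B l lT; have [A ATs lA] := TsP _ _ lT.
have [L1 [L2 [r [e s2]]]] := blocks_split ATs.
move: xsL; rewrite e => /all2_cat_split[x1 [x23 [-> r1]]].
move=> /all2_cat_split[x2 [x3 [-> r2 r3]]].
apply: (tower_block_small lT (r := r)).
- by rewrite (all2_size r2) size_nseq.
- by move=> x xx2; apply: lA; exact: (all2_nseqr r2 xx2).
- by rewrite (all2_size r3).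
Qed.

(** The cell containing two powers of [y] depends on the tower, but the
    difference of the two exponents divides [N`!]. *)
Lemma small_torsion (x y : G) :
  commute [~ x, y]%g x -> commute [~ x, y]%g y -> ([~ x, y] ^+ N`! = 1)%g.
Proof.
move=> zx zy; apply: small1 => B l lT; have [k kl] := tower_cells lT.
pose p (i : 'I_N.+1) := k (y ^+ i)%g.
have [i [j [ij kij]]] : exists i j : 'I_N.+1, (i < j)%N /\ p i = p j.
  have /injectivePn[i [j ij kij]] : ~~ injectiveb p.
    by apply/injectiveP => /leq_card; rewrite !card_ord ltnn.
  have [lij|] := ltnP i j; first by exists i, j.
  rewrite leq_eqVlt => /predU1P[/val_inj ji|lji]; last by exists j, i.
  by rewrite ji eqxx in ij.
have ly : l 1%N (y ^+ (j - i))%g <= 1.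
  have := kl _ _ kij; rewrite expgnFr ?(ltnW ij) //.
  have -> : ((y ^+ i)^-1 * y ^+ j = y ^+ j / y ^+ i)%g => //.
  by apply/commute_sym/commuteV/commuteX2.
have jiN : (0 < j - i <= N)%N.
  by rewrite subn_gt0 ij /= (leq_trans (leq_subr _ _)) // -ltnS.
have /dvdnP[q ->] := dvdn_fact jiN.
by rewrite mulnC; exact: (tower_central_powers lT).
Qed.

Theorem small_virtually_abelian : exists K : set G,
  [/\ subgrp K, fin_idx K & forall x y, K x -> K y -> commute x y].
Proof.
have [H [c [sH fH Hc]]] := small_nilpotent.
apply: (nilpotent_descent (fact_gt0 N) genS small_torsion sH fH (c := c)) => y _.
exact: Hc.
Qed.

End Main.

(** * Towers from operators commuting with a unitary action *)

Record inner_product (R : realType) (V : zmodType) (ip : V -> V -> R) : Prop :=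
  InnerProduct {
  ipC : forall u v, ip u v = ip v u;
  ipDl : forall u v w, ip (u + v) w = ip u w + ip v w;
  ip_ge0 : forall u, 0 <= ip u u;
  ip_CS : forall u v, ip u v ^+ 2 <= ip u u * ip v v
}.

(** A quadratic polynomial without sign change has non-positive discriminant;
    this gives the Cauchy-Schwarz inequality for semi-definite forms. *)
Lemma discriminant_le (R : realType) (a b c : R) : 0 <= c ->
  (forall t, 0 <= a + 2 * t * b + t ^+ 2 * c) -> b ^+ 2 <= a * c.
Proof.
move=> c0 H; have [c_eq0|c_neq0] := eqVneq c 0.
  have [->|b0] := eqVneq b 0; first by rewrite c_eq0 expr0n /= mulr0.
  have := H (- (a + 1) / (2 * b)); rewrite c_eq0.
  have -> : a + 2 * (- (a + 1) / (2 * b)) * b + (- (a + 1) / (2 * b)) ^+ 2 * 0 = -1.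
    by field.
  lra.
have {}c0 : 0 < c by rewrite lt_neqAle eq_sym c_neq0.
have := H (- b / c); have -> : a + 2 * (- b / c) * b + (- b / c) ^+ 2 * c =
  (a * c - b ^+ 2) / c by field.
by rewrite pmulr_lge0 ?invr_gt0 // subr_ge0.
Qed.

Section Norm.
Variables (R : realType) (V : zmodType) (ip : V -> V -> R).
Hypothesis ipV : inner_product ip.

Definition ipnorm (u : V) : R := Num.sqrt (ip u u).

Lemma ip0l w : ip 0 w = 0.
Proof. by apply: (addrI (ip 0 w)); rewrite -(ipDl ipV) !addr0. Qed.

Lemma ipNl u w : ip (- u) w = - ip u w.
Proof. by apply/eqP; rewrite -addr_eq0 -(ipDl ipV) addNr ip0l. Qed.

Lemma ipnorm_ge0 u : 0 <= ipnorm u. Proof. exact: sqrtr_ge0. Qed.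

Lemma ipnorm_sqr u : ipnorm u ^+ 2 = ip u u.
Proof. by rewrite sqr_sqrtr // (ip_ge0 ipV). Qed.

Lemma ipnormN u : ipnorm (- u) = ipnorm u.
Proof. by rewrite /ipnorm ipNl (ipC ipV) ipNl opprK. Qed.

Lemma ip_le_norm u v : ip u v <= ipnorm u * ipnorm v.
Proof.
rewrite /ipnorm -sqrtrM ?(ip_ge0 ipV) // (le_trans (ler_norm _)) //.
by rewrite -sqrtr_sqr ler_wsqrtr // (ip_CS ipV).
Qed.

Lemma ipnormD u v : ipnorm (u + v) <= ipnorm u + ipnorm v.
Proof.
rewrite -(@ler_pXn2r _ 2) // ?nnegrE ?addr_ge0 ?ipnorm_ge0 //.
rewrite sqrrD !ipnorm_sqr (ipDl ipV) (ipC ipV) (ipC ipV v) !(ipDl ipV).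
have := ip_le_norm u v; rewrite (ipC ipV v u); lra.
Qed.

Lemma ipnormB u v : ipnorm (u - v) <= ipnorm u + ipnorm v.
Proof. by rewrite -(ipnormN v) ipnormD. Qed.

End Norm.

Section OperatorTower.
Variables (R : realType) (G : groupType) (V : zmodType) (ip : V -> V -> R).
Variables (lam : G -> V -> V) (T : V -> V).
Hypothesis ipV : inner_product ip.
Hypothesis lam1 : forall u, lam 1%g u = u.
Hypothesis lamM : forall g h u, lam (g * h)%g u = lam g (lam h u).
Hypothesis lamB : forall g u v, lam g (u - v) = lam g u - lam g v.
Hypothesis lam_ip : forall g u, ip (lam g u) (lam g u) = ip u u.
Hypothesis TB : forall u v, T (u - v) = T u - T v.
Hypothesis T_sym : forall u v, ip (T u) v = ip u (T v).
Hypothesis T_lam : forall g u, T (lam g u) = lam g (T u).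
Hypothesis T_bounded : exists2 C, 0 <= C & forall u, ipnorm ip (T u) <= C * ipnorm ip u.

Local Notation nrm := (ipnorm ip).

Definition displacement g u := u - lam g u.

Lemma nrm_lam g u : nrm (lam g u) = nrm u.
Proof. by rewrite /ipnorm lam_ip. Qed.

Lemma T_displacement M g u : iter M T (displacement g u) = displacement g (iter M T u).
Proof. by elim: M => //= M ->; rewrite /displacement TB T_lam. Qed.

Lemma T_iter_lam M g u : iter M T (lam g u) = lam g (iter M T u).
Proof. by elim: M => //= M ->; rewrite T_lam. Qed.

Lemma T_iter_sym M u v : ip (iter M T u) v = ip u (iter M T v).
Proof. by elim: M u v => //= M IH u v; rewrite T_sym IH -iterSr. Qed.

Definition op_bounds M g : set R :=
  [set c | 0 <= c /\ forall u, nrm (displacement g (iter M T u)) <= c * nrm u].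

(** The norm of [(1 - lam g) T^M], as the least bound: in this form no unit
    vectors are needed, and vectors of norm zero cause no trouble. *)
Definition op_tower M g : R := inf (op_bounds M g).

Lemma displacement_le g u : nrm (displacement g u) <= 2 * nrm u.
Proof.
by rewrite (le_trans (ipnormB ipV _ _)) // nrm_lam mulr_natl mulr2n.
Qed.

Lemma op_bounds_nonempty M g : op_bounds M g !=set0.
Proof.
have [C C0 TC] := T_bounded; exists (2 * C ^+ M).
split=> [|u]; first by rewrite mulr_ge0 ?exprn_ge0.
rewrite (le_trans (displacement_le _ _)) // -mulrA ler_wpM2l //.
elim: M => [|M IH] /=; first by rewrite mul1r.
by rewrite (le_trans (TC _)) // exprS -mulrA ler_wpM2l.
Qed.

Lemma op_bounds_lb M g : lbound (op_bounds M g) 0.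
Proof. by move=> c []. Qed.

Lemma op_tower_ge0 M g : 0 <= op_tower M g.
Proof. exact: lb_le_inf (op_bounds_nonempty M g) (@op_bounds_lb M g). Qed.

Lemma op_tower_le M g c : 0 <= c ->
  (forall u, nrm (displacement g (iter M T u)) <= c * nrm u) -> op_tower M g <= c.
Proof. by move=> c0 cP; apply: ge_inf => //; exists 0; exact: op_bounds_lb. Qed.

Lemma op_towerP M g u : nrm (displacement g (iter M T u)) <= op_tower M g * nrm u.
Proof.
have [u0|u0] := eqVneq (nrm u) 0.
  have [c [_ /(_ u)]] := op_bounds_nonempty M g.
  by rewrite u0 !mulr0.
have {}u0 : 0 < nrm u by rewrite lt_neqAle eq_sym u0 ipnorm_ge0.
rewrite -ler_pdivrMr //; apply: lb_le_inf; first exact: op_bounds_nonempty.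
by move=> c [_ cP]; rewrite /= ler_pdivrMr.
Qed.

(** The commutator inequality comes from writing [1 - [~ g, h]] as a translate
    of [(1 - h) (1 - g) - (1 - g) (1 - h)], and the root inequality from moving
    one factor [T^M] across the inner product. *)
Lemma op_length_tower N :
  (exists k : G -> 'I_N, forall x y, k x = k y -> op_tower 1 (x^-1 * y)%g <= 1) ->
  length_tower N 2 op_tower.
Proof.
move=> cells; split=> //.
- by lra.
- exact: op_tower_ge0.
- by move=> g; apply: op_tower_le => //= u; exact: displacement_le.
- move=> M g; apply: op_tower_le => [|u]; first exact: op_tower_ge0.
  rewrite (_ : displacement _ _ = - lam g^-1%g (displacement g (iter M T u))).
    by rewrite ipnormN // nrm_lam op_towerP.
  by rewrite /displacement lamB -lamM mulVg lam1 opprB.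
- move=> M g h; apply: op_tower_le => [|u]; first by rewrite addr_ge0 ?op_tower_ge0.
  rewrite (_ : displacement _ _ = displacement g (iter M T u) + lam g (displacement h (iter M T u))).
    by rewrite mulrDl (le_trans (ipnormD ipV _ _)) // nrm_lam lerD ?op_towerP.
  by rewrite /displacement lamB lamM addrA subrK.
- move=> M g h; apply: op_tower_le => [|u]; first exact: op_tower_ge0.
  rewrite (_ : displacement _ _ = lam h^-1%g (displacement g (iter M T (lam h u)))).
    by rewrite nrm_lam -(nrm_lam h u) op_towerP.
  by rewrite /displacement lamB T_iter_lam -(lamM h^-1%g h) mulVg lam1 conjgE !lamM.
- move=> M M' g h; apply: op_tower_le => [|u].
    by rewrite !mulr_ge0 ?op_tower_ge0.
  set w := iter _ T u.
  rewrite (_ : displacement _ _ = lam (g^-1 * h^-1)%g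
    (displacement h (displacement g w) - displacement g (displacement h w))); last first.
    rewrite (_ : displacement h (displacement g w) - displacement g (displacement h w) =
        lam (h * g)%g w - lam (g * h)%g w).
      rewrite lamB -2!lamM (_ : g^-1 * h^-1 * (h * g) = 1)%g; last by group_simp.
      rewrite (_ : g^-1 * h^-1 * (g * h) = [~ g, h])%g; last by group_simp.
      by rewrite lam1.
    rewrite /displacement !lamB !lamM; 
    move: (lam g w) (lam h w) (lam h (lam g w)) (lam g (lam h w)).
    move=> b c d e; rewrite (opprB c d) (addrC d) addrACA [- (w - c - _)]opprD.
    by rewrite [LHS]addrACA subrr add0r opprK (addrC _ d) addrA subrK.
  rewrite nrm_lam (le_trans (ipnormB ipV _ _)) //.
  have comm2 (a b : G) m m' : nrm (displacement a (displacement b (iter (m + m') T u))) <=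
      op_tower m a * op_tower m' b * nrm u.
    rewrite iterD -T_displacement (le_trans (op_towerP _ _ _)) // -mulrA.
    by rewrite ler_wpM2l ?op_tower_ge0 // op_towerP.
  have := comm2 g h M M'; have := comm2 h g M' M; rewrite addnC -/w; lra.
- move=> M g; rewrite -[X in X <= _]sqr_sqrtr ?sqr_ge0 //.
  rewrite -[leRHS]sqr_sqrtr ?mulr_ge0 ?op_tower_ge0 //.
  rewrite ler_pXn2r ?nnegrE ?sqrtr_ge0 // sqrtr_sqr ger0_norm ?op_tower_ge0 //.
  apply: op_tower_le => [|u]; first exact: sqrtr_ge0.
  rewrite -(@ler_pXn2r _ 2) // ?nnegrE ?mulr_ge0 ?sqrtr_ge0 //.
  rewrite exprMn !(ipnorm_sqr ipV) sqr_sqrtr ?mulr_ge0 ?op_tower_ge0 //.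
  rewrite -{2}T_displacement -T_iter_sym T_displacement -iterD.
  rewrite (le_trans (ip_le_norm ipV _ _)) //.
  have := ler_pM (ipnorm_ge0 _ _) (ipnorm_ge0 _ _) (op_towerP (M + M) g u) (displacement_le g u).
  by move=> /le_trans; apply; rewrite -(ipnorm_sqr ipV) le_eqVlt; apply/orP; left; apply/eqP; ring.
Qed.

End OperatorTower.

(** * Almost periodic functions and their averages *)

Section Average.
Variables (R : realType) (I : Type).
Implicit Types (F : seq I) (h : I -> R).

Definition avg F h : R := (\sum_(a <- F) h a) / (size F)%:R.

Lemma eq_avg F h h' : h =1 h' -> avg F h = avg F h'.
Proof. by move=> hh'; congr (_ / _); apply: eq_bigr. Qed.

Lemma avgD F h h' : avg F (fun a => h a + h' a) = avg F h + avg F h'.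
Proof. by rewrite /avg big_split mulrDl. Qed.

Lemma avgB F h h' : avg F (fun a => h a - h' a) = avg F h - avg F h'.
Proof. by rewrite /avg sumrB mulrBl. Qed.

Lemma avgZ F c h : avg F (fun a => c * h a) = c * avg F h.
Proof. by rewrite /avg -mulr_sumr mulrA. Qed.

Lemma avg_cst F c : (0 < size F)%N -> avg F (fun=> c) = c.
Proof.
move=> F0; rewrite /avg big_const_seq count_predT iter_addr_0 -(mulr_natr c) mulfK //.
by rewrite pnatr_eq0 -lt0n.
Qed.

Lemma le_avg F h h' : (forall a, h a <= h' a) -> avg F h <= avg F h'.
Proof. by move=> hh'; rewrite ler_wpM2r ?invr_ge0 // ler_sum. Qed.

Lemma avg_near F h c e : (0 < size F)%N -> (forall a, `|h a - c| <= e) ->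
  `|avg F h - c| <= e.
Proof.
move=> F0 he; rewrite ler_distl -(avg_cst (c - e) F0) -(avg_cst (c + e) F0).
by apply/andP; split; apply: le_avg => a; have := he a; rewrite ler_distl => /andP[].
Qed.

End Average.

Lemma avg_swap (R : realType) (I J : Type) (F : seq I) (E : seq J) (h : I -> J -> R) :
  avg F (fun a => avg E (h a)) = avg E (fun b => avg F (h^~ b)).
Proof.
by rewrite /avg -!mulr_suml exchange_big /= mulrAC.
Qed.

Section AlmostPeriodic.
Variables (R : realType) (G : groupType).
Implicit Types (f g : G -> R) (F E : seq G).

(** Two-sided uniform continuity in the form used by Maak: the cells control
    the oscillation of all two-sided translates of [f] at once. *)
Definition modulus (T : finType) (k : G -> T) (e : R) f := forall x y, k x = k y ->
  forall a b, `|f (a * x * b)%g - f (a * y * b)%g| <= e.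

(** For the function obtained from a continuous function on a compact group by
    composing with a homomorphism, the cells come from a finite cover. *)
Definition almost_periodic f : Prop := forall e, 0 < e ->
  exists (T : finType) (k : G -> T), modulus k e f.

Definition lavg F f x := avg F (fun a => f (a * x)%g).
Definition ravg F f x := avg F (fun a => f (x * a)%g).

Definition is_lmean f c := forall e, 0 < e ->
  exists2 F, (0 < size F)%N & forall x, `|lavg F f x - c| <= e.
Definition is_rmean f c := forall e, 0 < e ->
  exists2 F, (0 < size F)%N & forall x, `|ravg F f x - c| <= e.

Lemma ap_bounded f : almost_periodic f -> exists2 C, 0 <= C & forall x, `|f x| <= C.
Proof.
move=> /(_ 1 ltr01)[T [k kf]].
pose r (t : T) := xget 1%g [set x | k x = t].
exists (\sum_t `|f (r t)| + 1) => [|x]; first by rewrite addr_ge0 ?sumr_ge0.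
have kr : k (r (k x)) = k x by rewrite /r; case: xgetP => [y _ //|/(_ x) []].
have := kf _ _ kr 1%g 1%g; rewrite !mul1g !mulg1 distrC => fx.
have : `|f (r (k x))| <= \sum_t `|f (r t)|.
  by rewrite (bigD1 (k x)) //= lerDl sumr_ge0.
have := ler_normD (f x - f (r (k x))) (f (r (k x))); rewrite subrK; lra.
Qed.

Lemma ap_cst c : almost_periodic (fun=> c).
Proof.
move=> e e0; exists unit, (fun=> tt) => x y _ a b.
by rewrite subrr normr0 ltW.
Qed.

Lemma ap_comb f g c : almost_periodic f -> almost_periodic g ->
  almost_periodic (fun x => c * f x + g x).
Proof.
move=> fP gP e e0; have e'0 : 0 < e / (2 * (`|c| + 1)).
  by rewrite divr_gt0 // mulr_gt0 // ltr_wpDl.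
have [T [k kf]] := fP _ e'0; have e20 : 0 < e / 2 by lra.
have [T' [k' kg]] := gP _ e20; exists (T * T')%type, (fun x => (k x, k' x)).
move=> x y xy a b; case: xy => /kf/(_ a b) fxy /kg/(_ a b) gxy.
rewrite opprD addrACA -mulrBr (le_trans (ler_normD _ _)) // normrM.
have -> : e = e / 2 + e / 2 by lra.
apply: lerD => //; apply: (@le_trans _ _ ((`|c| + 1) * (e / (2 * (`|c| + 1))))).
  by apply: ler_pM => //; lra.
rewrite le_eqVlt; apply/orP; left; apply/eqP; field.
by rewrite gt_eqF // ltr_wpDl.
Qed.

Lemma ap_mul f g : almost_periodic f -> almost_periodic g ->
  almost_periodic (fun x => f x * g x).
Proof.
move=> fP gP e e0; have [C C0 fC] := ap_bounded fP; have [D D0 gD] := ap_bounded gP.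
pose d := e / (C + D + 1).
have CD : 0 < C + D + 1 by lra.
have d0 : 0 < d by rewrite divr_gt0.
have [T [k kf]] := fP _ d0; have [T' [k' kg]] := gP _ d0.
exists (T * T')%type, (fun x => (k x, k' x)).
move=> x y xy a b; case: xy => /kf/(_ a b) fxy /kg/(_ a b) gxy.
set p := f _ in fxy *; set q := f _ in fxy *.
set r := g _ in gxy *; set s := g _ in gxy *.
have -> : p * r - q * s = (p - q) * r + q * (r - s) by ring.
rewrite (le_trans (ler_normD _ _)) // !normrM.
have := ler_pM (normr_ge0 _) (normr_ge0 _) fxy (gD (a * x * b)%g).
have := ler_pM (normr_ge0 _) (normr_ge0 _) (fC (a * y * b)%g) gxy.
have : d * (C + D + 1) = e by rewrite divfK // gt_eqF.
rewrite -/p -/q -/r -/s; lra.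
Qed.

Lemma ap_lr f u v : almost_periodic f -> almost_periodic (fun x => f (u * x * v)%g).
Proof.
move=> fP e e0; have [T [k kf]] := fP _ e0; exists T, k => x y kxy a b.
by have := kf _ _ kxy (u * a)%g (b * v)%g; rewrite !mulgA.
Qed.

Lemma ap_inv f : almost_periodic f -> almost_periodic (fun x => f x^-1%g).
Proof.
move=> fP e e0; have [T [k kf]] := fP _ e0; exists T, (fun x => k x^-1%g).
move=> x y kxy a b; have := kf _ _ kxy b^-1%g a^-1%g.
by rewrite !invgM !mulgA.
Qed.

Lemma modulus_lavg (T : finType) (k : G -> T) e f F : (0 < size F)%N ->
  modulus k e f -> modulus k e (lavg F f).
Proof.
move=> F0 kf x y kxy a b; rewrite /lavg.
rewrite -avgB -[X in `|X|]subr0; apply: avg_near => // c; rewrite subr0.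
by have := kf _ _ kxy (c * a)%g b; rewrite !mulgA.
Qed.

Lemma ap_lavg f F : (0 < size F)%N -> almost_periodic f -> almost_periodic (lavg F f).
Proof.
move=> F0 fP e e0; have [T [k kf]] := fP _ e0; exists T, k.
exact: modulus_lavg.
Qed.

Lemma lavg_comp E F f x :
  lavg E (lavg F f) x = lavg [seq (a * b)%g | b <- E, a <- F] f x.
Proof.
rewrite /lavg /avg big_allpairs_dep size_allpairs natrM invfM.
rewrite -mulr_suml mulrA mulrAC; congr (_ / _ / _).
by apply: eq_bigr => b _; apply: eq_bigr => a _; rewrite mulgA.
Qed.

Lemma lavg_ravg E F f x : lavg F (ravg E f) x = ravg E (lavg F f) x.
Proof.
rewrite /lavg /ravg avg_swap; apply: eq_avg => b; apply: eq_avg => a.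
by rewrite mulgA.
Qed.

Lemma ravg_inv F f x :
  ravg F f x = lavg [seq a^-1%g | a <- F] (fun y => f y^-1%g) x^-1%g.
Proof.
rewrite /lavg /ravg /avg size_map big_map; congr (_ / _).
by apply: eq_bigr => a _; rewrite invgM !invgK.
Qed.

(** If [f] is somewhere below the middle of its range, then for every [x] one
    of the translates by representatives of the cells takes [x] near such a
    place, so averaging over the representatives lowers the maximum. Otherwise
    the range itself can be halved. *)
Lemma lavg_shrink (T : finType) (k : G -> T) e f lo hi : 0 <= e -> modulus k e f ->
  (forall x, lo <= f x <= hi) -> exists F lo' hi', [/\ (0 < size F)%N,
    forall x, lo' <= lavg F f x <= hi' &
    hi' - lo' <= (hi - lo) - ((hi - lo) / 2 - e) / #|T|%:R].
Proof.
move=> e0 kf fb; have T0 : (0 < #|T|)%N by apply/card_gt0P; exists (k 1%g).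
have T1 : 0 < (#|T|%:R^-1 : R) <= 1.
  by rewrite invr_gt0 ltr0n T0 invf_le1 ?ltr0n // ler1n.
pose mid := (lo + hi) / 2.
have [[x0 fx0]|nex] := pselect (exists x0, f x0 <= mid); last first.
  exists [:: 1%g], mid, hi; split=> // [x|].
    rewrite /lavg /avg big_seq1 mul1g divr1; have /andP[_ ->] := fb x.
    by rewrite andbT leNgt; apply/negP => /ltW fx; apply: nex; exists x.
  have lh : lo <= hi by have /andP[] := fb 1%g; exact: le_trans.
  rewrite /mid; set w := hi - lo; have w0 : 0 <= w by rewrite subr_ge0.
  have -> : hi - (lo + hi) / 2 = w / 2 by rewrite /w; lra.
  set d := _^-1 in T1 *; case/andP: T1 => d0 d1.
  have : (w / 2 - e) * d <= w / 2 * d by apply: ler_wpM2r; lra.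
  have : w / 2 * d <= w / 2 * 1 by apply: ler_wpM2l; lra.
  lra.
pose r (t : T) := xget 1%g [set x | k x = t].
have kr x : k (r (k x)) = k x by rewrite /r; case: xgetP => [y _ //|/(_ x) []].
have size_r : size [seq r t | t <- enum T] = #|T| by rewrite size_map -cardE.
exists [seq r t | t <- enum T], lo, (hi - (hi - mid - e) / #|T|%:R).
split=> [|x|]; first by rewrite size_r.
  apply/andP; split.
    rewrite -[leLHS](@avg_cst _ _ [seq r t | t <- enum T]) ?size_r //.
    by apply: le_avg => a; case/andP: (fb (a * x)%g).
  rewrite /lavg /avg size_r big_map big_enum /= lerBrDl -mulrDl.
  rewrite ler_pdivrMr ?ltr0n //.
  have -> : hi * #|T|%:R = \sum_(t : T) hi by rewrite sumr_const mulr_natr.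
  (* The representative of the cell of [x0 * x^-1] takes [x] near [x0]. *)
  rewrite (bigD1 (k (x0 * x^-1)%g)) //= [leRHS](bigD1 (k (x0 * x^-1)%g)) //=.
  rewrite addrA lerD //; last by apply: ler_sum => t _; case/andP: (fb (r t * x)%g).
  have := kf _ _ (kr (x0 * x^-1)%g) 1%g x; rewrite !mul1g mulgVK.
  rewrite ler_distl => /andP[_]; lra.
rewrite /mid; have -> : hi - (lo + hi) / 2 - e = (hi - lo) / 2 - e by lra.
lra.
Qed.

(** The oscillation decreases by a fixed amount [s] at each step of
    [lavg_shrink] as long as it exceeds [e], because averages keep the modulus
    of [f]. *)
Lemma lavg_osc f e : almost_periodic f -> 0 < e ->
  exists F lo, (0 < size F)%N /\ forall x, lo <= lavg F f x <= lo + e.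
Proof.
move=> fP e0; have d0 : 0 < e / 4 by lra.
have [T [k kf]] := fP _ d0; have [C C0 fC] := ap_bounded fP.
have T0 : (0 < #|T|)%N by apply/card_gt0P; exists (k 1%g).
pose s := e / 4 / #|T|%:R.
have s0 : 0 < s by rewrite divr_gt0 // ltr0n.
have step n : exists F lo hi, [/\ (0 < size F)%N,
    forall x, lo <= lavg F f x <= hi & hi - lo <= e \/ hi - lo <= 2 * C - n%:R * s].
  elim: n => [|n [F [lo [hi [F0 Fb]]]]].
    exists [:: 1%g], (- C), C; split=> //; last by right; lra.
    by move=> x; rewrite /lavg /avg big_seq1 mul1g divr1 -ler_norml.
  case=> [small|big]; first by exists F, lo, hi; split=> //; left.
  have [ew|we] := leP (hi - lo) e; first by exists F, lo, hi; split=> //; left.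
  have [E [lo' [hi' [E0 Eb w']]]] := lavg_shrink (ltW d0) (modulus_lavg F0 kf) Fb.
  exists [seq (a * b)%g | b <- E, a <- F], lo', hi'; split.
  - by rewrite size_allpairs muln_gt0 E0.
  - by move=> x; rewrite -lavg_comp.
  - right; rewrite (le_trans w') //.
    have -> : n.+1%:R * s = n%:R * s + s by rewrite -(natr1 n) [LHS]mulrDl mul1r.
    have : s <= ((hi - lo) / 2 - e / 4) / #|T|%:R.
      by rewrite ler_wpM2r ?invr_ge0 //; lra.
    by move: big; lra.
have [n nC] : exists n, 2 * C < n%:R * s.
  exists (Num.bound (2 * C / s)); rewrite -ltr_pdivrMr //.
  by apply: archi_boundP; apply: divr_ge0; [exact: mulr_ge0|exact: ltW].
have [F [lo [hi [F0 Fb w]]]] := step n.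
exists F, lo; split=> // x; have /andP[lx xh] := Fb x; rewrite lx /=.
rewrite (le_trans xh) //; case: w; lra.
Qed.
End AlmostPeriodic.

(** * The invariant mean of an almost periodic function *)

Section Mean.
Variables (R : realType) (G : groupType).
Implicit Types (f g : G -> R) (F E : seq G).

Lemma is_rmean_inv f c : is_rmean f c <-> is_lmean (fun x => f x^-1%g) c.
Proof.
split=> fc e e0; have [F F0 Fc] := fc e e0; exists [seq a^-1%g | a <- F];
  rewrite ?size_map // => x.
  by have := Fc x^-1%g; rewrite ravg_inv invgK.
rewrite ravg_inv -map_comp (_ : map _ F = F) ?Fc //.
by rewrite -[RHS]map_id; apply: eq_map => a /=; rewrite invgK.
Qed.

Lemma ravg_osc f e : almost_periodic f -> 0 < e ->
  exists F lo, (0 < size F)%N /\ forall x, lo <= ravg F f x <= lo + e.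
Proof.
move=> fP e0; have [F [lo [F0 Fb]]] := lavg_osc (ap_inv fP) e0.
exists [seq a^-1%g | a <- F], lo; rewrite size_map; split=> // x.
rewrite ravg_inv -map_comp (_ : map _ F = F) ?Fb //.
by rewrite -[RHS]map_id; apply: eq_map => a /=; rewrite invgK.
Qed.

Lemma avg_bounds F (h : G -> R) lo hi : (0 < size F)%N ->
  (forall a, lo <= h a <= hi) -> lo <= avg F h <= hi.
Proof.
move=> F0 hb; rewrite -(avg_cst lo F0) -(avg_cst hi F0).
by apply/andP; split; apply: le_avg => a; case/andP: (hb a).
Qed.

(** A lower bound of a left average never exceeds an upper bound of another
    one. So every left average of small oscillation lies close to the supremum of
    all lower bounds. *)
Lemma lmean_exists f : almost_periodic f -> exists c, is_lmean f c.
Proof.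
move=> fP.
pose Lo := [set lo | exists2 F, (0 < size F)%N & forall x, lo <= lavg F f x].
(* Left and right averages commute, so a right average that is nearly constant
     compares the values of any two left averages. *)
have cross F hi lo : (0 < size F)%N -> (forall x, lavg F f x <= hi) -> Lo lo -> lo <= hi.
  move=> F0 Fhi [F' F'0 F'lo]; apply/ler_addgt0Pr => e e0.
  have [E [r [E0 Er]]] := ravg_osc fP e0.
  have h2 : lo <= ravg E (lavg F' f) 1%g.
    by rewrite -(avg_cst lo E0); apply: le_avg => a; exact: F'lo.
  have h3 : ravg E (lavg F f) 1%g <= hi.
    by rewrite -(avg_cst hi E0); apply: le_avg => a; exact: Fhi.
  rewrite -!lavg_ravg in h2 h3.
  have /andP[_ h4] := avg_bounds F'0 (fun a => Er (a * 1)%g).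
  have /andP[h5 _] := avg_bounds F0 (fun a => Er (a * 1)%g).
  by move: h2 h3 h4 h5; rewrite /lavg; lra.
have [C C0 fC] := ap_bounded fP.
have Lo0 : Lo !=set0.
  exists (- C), [:: 1%g] => // x; rewrite /lavg /avg big_seq1 mul1g divr1.
  by have := fC x; rewrite ler_norml => /andP[].
have LoC : has_ubound Lo.
  exists C => lo; apply: (cross [:: 1%g]) => // x.
  rewrite /lavg /avg big_seq1 mul1g divr1.
  by have := fC x; rewrite ler_norml => /andP[].
exists (sup Lo) => e e0; have [F [lo [F0 Fb]]] := lavg_osc fP e0.
exists F => // x; have /andP[xl xh] := Fb x.
have Llo : Lo lo by exists F => // y; case/andP: (Fb y).
have h1 : lo <= sup Lo by exact: ub_le_sup.
have h2 : sup Lo <= lo + e.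
  by apply: ge_sup => // lo' Llo'; apply: (cross F) => // y; case/andP: (Fb y).
by rewrite ler_norml; apply/andP; split; lra.
Qed.

Lemma rmean_exists f : almost_periodic f -> exists c, is_rmean f c.
Proof.
move=> /ap_inv /lmean_exists[c fc]; exists c; exact/is_rmean_inv.
Qed.

(** Averaging on both sides produces a number close to both means. This is why
    the mean is unique and invariant on both sides. *)
Lemma lmean_rmean f c d : is_lmean f c -> is_rmean f d -> c = d.
Proof.
move=> fc fd; apply/eqP; rewrite -subr_eq0 -normr_le0; apply/ler_addgt0Pr => e e0.
have e20 : 0 < e / 2 by lra.
have [F F0 Fc] := fc _ e20; have [E E0 Ed] := fd _ e20.
have h1 : `|ravg E (lavg F f) 1%g - c| <= e / 2 by apply: avg_near => // a; exact: Fc.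
have h2 : `|lavg F (ravg E f) 1%g - d| <= e / 2 by apply: avg_near => // a; exact: Ed.
rewrite add0r lavg_ravg in h2 *; set u := ravg _ _ _ in h1 h2.
have -> : c - d = (u - d) - (u - c) by ring.
by rewrite (le_trans (ler_normB _ _)) //; lra.
Qed.

Definition mean f : R := xget 0 (is_lmean f).

Lemma mean_l f : almost_periodic f -> is_lmean f (mean f).
Proof. by move=> /lmean_exists[c fc]; rewrite /mean; case: xgetP => [//|/(_ c) []]. Qed.

Lemma mean_r f : almost_periodic f -> is_rmean f (mean f).
Proof.
by move=> fP; have [d fd] := rmean_exists fP; rewrite (lmean_rmean (mean_l fP) fd).
Qed.

Lemma mean_uniql f c : almost_periodic f -> is_lmean f c -> mean f = c.
Proof. by move=> fP fc; rewrite (lmean_rmean fc (mean_r fP)). Qed.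

Lemma mean_uniqr f c : almost_periodic f -> is_rmean f c -> mean f = c.
Proof. by move=> fP fc; rewrite (lmean_rmean (mean_l fP) fc). Qed.

Lemma mean_lavg f F : (0 < size F)%N -> almost_periodic f -> mean (lavg F f) = mean f.
Proof.
move=> F0 fP; apply: mean_uniqr; first exact: ap_lavg.
move=> e e0; have [E E0 Ee] := mean_r fP e0; exists E => // x.
by rewrite -lavg_ravg; apply: avg_near.
Qed.

(** Averaging an average keeps what has been achieved for the earlier
    functions, so finitely many functions can be treated in turn. *)
Lemma simultaneous_mean (I : eqType) (s : seq I) (fs : I -> G -> R) e :
  (forall i, almost_periodic (fs i)) -> 0 < e ->
  exists2 F, (0 < size F)%N &
    forall i, i \in s -> forall x, `|lavg F (fs i) x - mean (fs i)| <= e.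
Proof.
move=> fsP e0; elim: s => [|i s [F F0 Fs]]; first by exists [:: 1%g].
have [E E0 Ei] := mean_l (ap_lavg F0 (fsP i)) e0.
exists [seq (a * b)%g | b <- E, a <- F]; first by rewrite size_allpairs muln_gt0 E0.
move=> j; rewrite inE => /predU1P[->|js] x; rewrite -lavg_comp.
  by have := Ei x; rewrite mean_lavg.
by apply: avg_near => // a; exact: Fs.
Qed.

Lemma mean_comb f g c : almost_periodic f -> almost_periodic g ->
  mean (fun x => c * f x + g x) = c * mean f + mean g.
Proof.
move=> fP gP; apply: mean_uniql; first exact: ap_comb.
move=> e e0; pose d := e / (`|c| + 1).
have c0 : 0 < `|c| + 1 by rewrite ltr_wpDl.
have d0 : 0 < d by rewrite divr_gt0.
pose fs (b : bool) := if b then f else g.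
have fsP b : almost_periodic (fs b) by case: b.
have [F F0 Fe] := simultaneous_mean [:: true; false] fsP d0.
exists F => // x; have := Fe true isT x; have := Fe false isT x; rewrite /fs.
have -> : lavg F (fun x => c * f x + g x) x = c * lavg F f x + lavg F g x.
  by rewrite /lavg avgD avgZ.
move=> gx fx; rewrite opprD addrACA -mulrBr.
rewrite (le_trans (ler_normD _ _)) // normrM.
have : `|c| * `|lavg F f x - mean f| <= `|c| * d by apply: ler_wpM2l.
have : d * (`|c| + 1) = e by rewrite divfK // gt_eqF.
lra.
Qed.

Lemma mean_cst c : mean (fun=> c) = c.
Proof.
apply: mean_uniql; first exact: ap_cst.
move=> e e0; exists [:: 1%g] => // x.
by rewrite /lavg avg_cst // subrr normr0 ltW.
Qed.

Lemma meanZ f c : almost_periodic f -> mean (fun x => c * f x) = c * mean f.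
Proof.
move=> fP; have := mean_comb c fP (ap_cst G 0); rewrite mean_cst addr0 => <-.
by congr mean; apply/funext => x; rewrite addr0.
Qed.

Lemma meanD f g : almost_periodic f -> almost_periodic g ->
  mean (fun x => f x + g x) = mean f + mean g.
Proof.
move=> fP gP; have := mean_comb 1 fP gP; rewrite mul1r => <-.
by congr mean; apply/funext => x; rewrite mul1r.
Qed.

Lemma ap_sub f g : almost_periodic f -> almost_periodic g ->
  almost_periodic (fun x => f x - g x).
Proof.
move=> fP gP; have := ap_comb (-1) gP fP.
by congr almost_periodic; apply/funext => x; rewrite mulN1r addrC.
Qed.

Lemma meanB f g : almost_periodic f -> almost_periodic g ->
  mean (fun x => f x - g x) = mean f - mean g.
Proof.
move=> fP gP; have := mean_comb (-1) gP fP; rewrite mulN1r addrC => <-.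
by congr mean; apply/funext => x; rewrite mulN1r addrC.
Qed.

Lemma mean_ge0 f : almost_periodic f -> (forall x, 0 <= f x) -> 0 <= mean f.
Proof.
move=> fP f0; apply/ler_addgt0Pr => e e0; have [F F0 Fe] := mean_l fP e0.
have : 0 <= lavg F f 1%g by rewrite mulr_ge0 ?invr_ge0 // sumr_ge0.
by have := Fe 1%g; rewrite ler_distl => /andP[]; lra.
Qed.

(** Finitely many translates of [f] have a sum bounded below by a positive
    constant. *)
Lemma mean_gt0 f x0 : almost_periodic f -> (forall x, 0 <= f x) -> 0 < f x0 ->
  0 < mean f.
Proof.
move=> fP f0 fx0; have e0 : 0 < f x0 / 2 by lra.
have [T [k kf]] := fP _ e0.
pose r (t : T) := xget 1%g [set x | k x = t].
have kr x : k (r (k x)) = k x by rewrite /r; case: xgetP => [y _ //|/(_ x) []].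
pose F := [seq r t | t <- enum T].
have sF : size F = #|T| by rewrite size_map -cardE.
have F0 : (0 < size F)%N by rewrite sF; apply/card_gt0P; exists (k 1%g).
pose c := f x0 / 2 / #|T|%:R.
have c0 : 0 < c by rewrite divr_gt0 // ltr0n -sF.
have low x : 0 <= lavg F f x - c.
  rewrite /lavg /avg sF -mulrBl mulr_ge0 ?invr_ge0 // big_map big_enum /=.
  (* The representative of the cell of [x0 * x^-1] takes [x] near [x0]. *)
  rewrite (bigD1 (k (x0 * x^-1)%g)) //=.
  have := kf _ _ (kr (x0 * x^-1)%g) 1%g x; rewrite !mul1g mulgVK.
  rewrite ler_distl => /andP[h _].
  have : 0 <= \sum_(t | t != k (x0 * x^-1)%g) f (r t * x)%g by apply: sumr_ge0.
  lra.
have Fap : almost_periodic (lavg F f) by exact: ap_lavg.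
have : 0 <= mean (fun x => lavg F f x - c).
  by apply: mean_ge0 => //; apply: ap_sub => //; exact: ap_cst.
rewrite meanB ?mean_cst ?mean_lavg ?subr_ge0 //; last exact: ap_cst.
exact: lt_le_trans.
Qed.

Lemma le_mean f g : almost_periodic f -> almost_periodic g ->
  (forall x, f x <= g x) -> mean f <= mean g.
Proof.
move=> fP gP fg; rewrite -subr_ge0.
rewrite -meanB //; apply: mean_ge0 => [|x]; first exact: ap_sub.
by rewrite subr_ge0.
Qed.

Lemma mean_norm_le f C : almost_periodic f -> (forall x, `|f x| <= C) -> `|mean f| <= C.
Proof.
move=> fP fC; rewrite ler_norml -{1}(mean_cst (- C)) -{2}(mean_cst C).
by apply/andP; split; apply: le_mean => //; try exact: ap_cst;
  move=> x; have := fC x; rewrite ler_norml => /andP[].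
Qed.

Lemma ap_l f u : almost_periodic f -> almost_periodic (fun x => f (u * x)%g).
Proof.
move=> /(ap_lr u 1%g) fP e e0; have [T [k kf]] := fP _ e0; exists T, k.
by move=> x y /kf + a b => /(_ a b); rewrite !mulg1.
Qed.

Lemma mean_left f u : almost_periodic f -> mean (fun x => f (u * x)%g) = mean f.
Proof.
move=> fP; apply: mean_uniqr; first exact: ap_l.
move=> e e0; have [E E0 Ee] := mean_r fP e0; exists E => // x.
have := Ee (u * x)%g; congr (`| _ - _ | <= _).
by apply: eq_avg => a; rewrite mulgA.
Qed.

Lemma mean_avg F (fs : G -> G -> R) : (forall a, almost_periodic (fs a)) ->
  almost_periodic (fun x => avg F (fs^~ x)) /\
  mean (fun x => avg F (fs^~ x)) = avg F (fun a => mean (fs a)).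
Proof.
move=> fsP; rewrite /avg.
suff [sP sE] : almost_periodic (fun x => \sum_(a <- F) fs a x) /\
    mean (fun x => \sum_(a <- F) fs a x) = \sum_(a <- F) mean (fs a).
  set d := _^-1.
  have eqd : (fun x => (\sum_(a <- F) fs a x) * d) =
    (fun x => d * (\sum_(a <- F) fs a x) + 0).
    by apply/funext => x; rewrite addr0 mulrC.
  rewrite eqd; split; first exact: ap_comb (ap_cst G 0).
  by rewrite mean_comb ?mean_cst ?addr0 ?sE 1?mulrC //; exact: ap_cst.
elim: F => [|a F [IHP IHE]].
  have -> : (fun x => \sum_(a <- [::]) fs a x) = (fun=> 0).
    by apply/funext => x; rewrite big_nil.
  by rewrite big_nil mean_cst; split=> //; exact: ap_cst.
have -> : (fun x => \sum_(b <- a :: F) fs b x) =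
    (fun x => 1 * fs a x + \sum_(b <- F) fs b x).
  by apply/funext => x; rewrite big_cons mul1r.
rewrite big_cons; split; first exact: ap_comb.
by rewrite mean_comb // mul1r IHE.
Qed.

(** By uniformity in [z] only finitely many sections have to be averaged, so
    one finite average in [x] approximates all inner means at the same time, and
    finite averages commute with the mean. *)
Lemma mean_fubini (P : G -> G -> R) :
  (forall e, 0 < e -> exists (T : finType) (k : G -> T),
     forall z z', k z = k z' -> forall x, `|P x z - P x z'| <= e) ->
  (forall z, almost_periodic (P^~ z)) -> (forall x, almost_periodic (P x)) ->
  almost_periodic (fun x => mean (P x)) -> almost_periodic (fun z => mean (P^~ z)) ->
  mean (fun x => mean (P x)) = mean (fun z => mean (P^~ z)).
Proof.
move=> unif Pz Px Mx Mz; apply: mean_uniql => // e e0.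
have d0 : 0 < e / 3 by lra.
have [T [k kP]] := unif _ d0.
pose r (t : T) := xget 1%g [set x | k x = t].
have kr x : k (r (k x)) = k x by rewrite /r; case: xgetP => [y _ //|/(_ x) []].
have [F F0 Fe] := simultaneous_mean (enum T) (fun t => Pz (r t)) d0.
exists F => // x.
have near z : `|lavg F (P^~ z) x - mean (P^~ z)| <= e.
  have := Fe (k z); rewrite mem_enum => /(_ isT x) h1.
  have h2 : `|lavg F (P^~ z) x - lavg F (P^~ (r (k z))) x| <= e / 3.
    rewrite -avgB -[X in `|X|]subr0; apply: avg_near => // a; rewrite subr0.
    exact: kP.
  have h3 : `|mean (P^~ z) - mean (P^~ (r (k z)))| <= e / 3.
    rewrite -meanB //; apply: mean_norm_le => [|y]; last exact: kP.
    exact: ap_sub.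
  move: h1 h2 h3; rewrite !ler_norml => /andP[? ?] /andP[? ?] /andP[? ?].
  by apply/andP; split; lra.
have [aP aE] := mean_avg F (fun a => Px (a * x)%g).
rewrite /lavg -aE -meanB //; apply: mean_norm_le => [|z]; last exact: near.
exact: ap_sub.
Qed.

End Mean.

(** * Convolution on the space of almost periodic functions *)

Section ApSpace.
Variables (R : realType) (G : groupType).

Definition ap_pred : {pred G -> R} := fun f => `[< almost_periodic f >].

Lemma ap_predP f : reflect (almost_periodic f) (f \in ap_pred).
Proof. exact: asboolP. Qed.

Lemma ap_zmod_closed : zmod_closed ap_pred.
Proof.
split=> [|f g /ap_predP fP /ap_predP gP]; first exact/ap_predP/ap_cst.
exact/ap_predP/ap_sub.
Qed.

HB.instance Definition _ := GRing.isZmodClosed.Build (G -> R) ap_pred ap_zmod_closed.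

Record ap_fun := ApFun { ap_val :> G -> R; _ : ap_val \in ap_pred }.
HB.instance Definition _ := [isSub for ap_val].
HB.instance Definition _ := [Choice of ap_fun by <:].
HB.instance Definition _ := [SubChoice_isSubZmodule of ap_fun by <:].

Implicit Types u v w : ap_fun.

Lemma apP u : almost_periodic u. Proof. exact/ap_predP/(valP u). Qed.

Definition mk_ap (f : G -> R) (fP : almost_periodic f) : ap_fun :=
  ApFun (introT (ap_predP f) fP).

Lemma ap_funB u v x : (u - v) x = u x - v x. Proof. by []. Qed.
Lemma ap_funD u v x : (u + v) x = u x + v x. Proof. by []. Qed.

Lemma ap_fun_inj u v : (forall x, u x = v x) -> u = v.
Proof. by move=> uv; apply: val_inj; apply/funext. Qed.

Definition ap_ip u v : R := mean (fun x => u x * v x).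

Lemma ap_inner_product : inner_product ap_ip.
Proof.
split=> [u v|u v w|u|u v].
- by congr mean; apply/funext => x; rewrite mulrC.
- rewrite /ap_ip -meanD; [|exact: ap_mul (apP _) (apP _)..].
  by congr mean; apply/funext => x; rewrite ap_funD mulrDl.
- apply: mean_ge0 => [|x]; first exact: ap_mul (apP _) (apP _).
  by rewrite -expr2 sqr_ge0.
- have uu := ap_mul (apP u) (apP u); have vv := ap_mul (apP v) (apP v).
  have uv := ap_mul (apP u) (apP v).
  apply: discriminant_le => [|t].
    by apply: mean_ge0 => // x; rewrite -expr2 sqr_ge0.
  rewrite /ap_ip (addrC (mean _)) -(mean_comb (2 * t) uv uu).
  rewrite addrC -mean_comb //; last exact: ap_comb.
  apply: mean_ge0 => [|x]; first by do 2!apply: ap_comb => //.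
  have -> : t ^+ 2 * (v x * v x) + (2 * t * (u x * v x) + u x * u x) =
    (u x + t * v x) ^+ 2 by ring.
  exact: sqr_ge0.
Qed.

Definition translate (g : G) u : ap_fun := mk_ap (ap_l g^-1%g (apP u)).

Lemma ap_norm_le u C : 0 <= C -> (forall x, `|u x| <= C) -> ipnorm ap_ip u <= C.
Proof.
move=> C0 uC; rewrite -(@ler_pXn2r _ 2) // ?nnegrE ?ipnorm_ge0 //.
rewrite (ipnorm_sqr ap_inner_product) (le_trans (ler_norm _)) //.
apply: mean_norm_le => [|x]; first exact: ap_mul (apP _) (apP _).
by rewrite normrM expr2 ler_pM.
Qed.

Section Convolution.
Variable F : G -> R.
Hypothesis FP : almost_periodic F.
Hypothesis F_sym : forall x, F x^-1%g = F x.
Variable d : R.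
Hypothesis d0 : 0 < d.

Lemma ap_kernel x : almost_periodic (fun z => F (z^-1 * x)%g).
Proof.
have := ap_l x^-1%g FP; congr almost_periodic; apply/funext => z.
by rewrite -F_sym invgM invgK.
Qed.

Lemma ap_conv_kernel u x : almost_periodic (fun z => u z * F (z^-1 * x)%g).
Proof. exact: ap_mul (apP u) (ap_kernel x). Qed.

(** In the notation of harmonic analysis this is the convolution of [u] with
    [F] on the right, which commutes with left translations. *)
Definition convolution u (x : G) : R := mean (fun z => u z * F (z^-1 * x)%g).

(** The Cauchy-Schwarz inequality against the difference of two translates of
    the kernel: the convolution turns square-mean bounds into uniform ones. *)
Lemma convolution_diff u x y e : 0 <= e ->
  (forall z, `|F (z^-1 * x)%g - F (z^-1 * y)%g| <= e) ->
  `|convolution u x - convolution u y| <= e * ipnorm ap_ip u.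
Proof.
move=> e0 Fe; rewrite /convolution -meanB; [|exact: ap_conv_kernel..].
pose k := mk_ap (ap_sub (ap_kernel x) (ap_kernel y)).
have -> : (fun z => u z * F (z^-1 * x)%g - u z * F (z^-1 * y)%g) =
  (fun z => u z * k z) by apply/funext => z; rewrite -mulrBr.
rewrite -/(ap_ip u k) mulrC; have kn : ipnorm ap_ip k <= e by exact: ap_norm_le.
have le1 (v : ap_fun) : ap_ip v k <= ipnorm ap_ip v * e.
  rewrite (le_trans (ip_le_norm ap_inner_product _ _)) //.
  by rewrite ler_wpM2l // ipnorm_ge0.
rewrite ler_norml le1 andbT lerNl -(ipNl ap_inner_product).
by rewrite -(ipnormN ap_inner_product u) le1.
Qed.

Lemma convolution_le u C : 0 <= C -> (forall x, `|F x| <= C) ->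
  forall x, `|convolution u x| <= C * ipnorm ap_ip u.
Proof.
move=> C0 FC x; pose k := mk_ap (ap_kernel x).
have kn : ipnorm ap_ip k <= C by apply: ap_norm_le => // z; exact: FC.
have le1 (v : ap_fun) : ap_ip v k <= ipnorm ap_ip v * C.
  rewrite (le_trans (ip_le_norm ap_inner_product _ _)) //.
  by rewrite ler_wpM2l // ipnorm_ge0.
rewrite -[convolution u x]/(ap_ip u k) mulrC ler_norml le1 andbT lerNl -(ipNl ap_inner_product).
by rewrite -(ipnormN ap_inner_product u) le1.
Qed.

Lemma ap_convolution u : almost_periodic (convolution u).
Proof.
move=> e e0; set n := ipnorm ap_ip u.
have n0 : 0 <= n by exact: ipnorm_ge0.
have e'0 : 0 < e / (n + 1) by rewrite divr_gt0 // ltr_wpDl.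
have [T [k kF]] := FP e'0; exists T, k => x y kxy a b.
rewrite (le_trans (@convolution_diff u _ _ _ (ltW e'0) _)) //.
  by move=> z; have := kF _ _ kxy (z^-1 * a)%g b; rewrite !mulgA.
rewrite -/n -mulrA ler_piMr //; first exact: ltW.
by rewrite mulrC ler_pdivrMr ?mul1r ?lerDl // ltr_wpDl.
Qed.

(** The factor [d^-1] normalises the tower: elements moving [F] by at most [d]
    get length at most [1]. *)
Definition smoothing u : ap_fun := mk_ap (ap_mul (ap_cst G d^-1) (ap_convolution u)).

(** Symmetry of the kernel and the exchange of two means. *)
Lemma smoothing_sym u v : ap_ip (smoothing u) v = ap_ip u (smoothing v).
Proof.
have pull (w w' : ap_fun) : ap_ip (smoothing w) w' =
    d^-1 * mean (fun x => mean (fun z => w z * F (z^-1 * x)%g * w' x)).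
  rewrite -meanZ; last first.
    have := ap_mul (ap_convolution w) (apP w'); congr almost_periodic.
    apply/funext => x; rewrite mulrC -meanZ; last exact: ap_conv_kernel.
    by congr mean; apply/funext => z; rewrite mulrC.
  congr mean; apply/funext => x /=; rewrite -mulrA; congr (_ * _).
  rewrite mulrC -meanZ; last exact: ap_conv_kernel.
  by congr mean; apply/funext => z; rewrite mulrC.
rewrite (ipC ap_inner_product u) !pull; congr (_ * _).
rewrite (@mean_fubini _ _ (fun x z => u z * F (z^-1 * x)%g * v x)).
- congr mean; apply/funext => z; congr mean; apply/funext => x.
  by rewrite -F_sym invgM invgK; ring.
- move=> e e0.
  have [Cu Cu0 uC] := ap_bounded (apP u); have [Cv Cv0 vC] := ap_bounded (apP v).
  have [CF CF0 FC] := ap_bounded FP.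
  pose a := e / ((Cu + CF + 1) * (Cv + 1)).
  have a0 : 0 < a by rewrite divr_gt0 // mulr_gt0 //; lra.
  have [T [k ku]] := apP u a0; have [T' [k' kF]] := FP a0.
  exists (T * T')%type, (fun z => (k z, k' z^-1%g)) => z z' [kz kz'] x.
  rewrite -mulrBl normrM.
  have hu : `|u z - u z'| <= a by have := ku _ _ kz 1%g 1%g; rewrite !mul1g !mulg1.
  have hF : `|F (z^-1 * x)%g - F (z'^-1 * x)%g| <= a.
    by have := kF _ _ kz' 1%g x; rewrite !mul1g.
  have h : `|u z * F (z^-1 * x)%g - u z' * F (z'^-1 * x)%g| <= a * (Cu + CF + 1).
    set p := u z in hu *; set q := u z' in hu *.
    set r := F _ in hF *; set s := F _ in hF *.
    have -> : p * r - q * s = (p - q) * r + q * (r - s) by ring.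
    rewrite (le_trans (ler_normD _ _)) // !normrM.
    have := ler_pM (normr_ge0 _) (normr_ge0 _) hu (FC (z^-1 * x)%g).
    have := ler_pM (normr_ge0 _) (normr_ge0 _) (uC z') hF.
    rewrite -/r -/q -/s; have := ltW a0; lra.
  have := ler_pM (normr_ge0 _) (normr_ge0 _) h (vC x); move/le_trans; apply.
  apply: (@le_trans _ _ (a * (Cu + CF + 1) * (Cv + 1))).
    apply: ler_wpM2l; last by rewrite lerDl.
    by apply: mulr_ge0; [exact: ltW|rewrite !addr_ge0].
  by rewrite -mulrA divfK // mulf_neq0 // gt_eqF //; lra.
- move=> z; have := ap_mul (ap_cst G (u z)) (ap_l z^-1%g FP).
  by move=> h; exact: ap_mul h (apP v).
- move=> x; exact: ap_mul (ap_conv_kernel u x) (ap_cst G (v x)).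
- have := ap_mul (ap_convolution u) (apP v); congr almost_periodic.
  apply/funext => x; rewrite mulrC -meanZ; last exact: ap_conv_kernel.
  by congr mean; apply/funext => z; rewrite mulrC.
- have := ap_mul (ap_convolution v) (apP u); congr almost_periodic.
  apply/funext => z; rewrite mulrC -meanZ; last exact: ap_conv_kernel.
  by congr mean; apply/funext => x; rewrite -(F_sym (x^-1 * z)%g) invgM invgK; ring.
Qed.

Lemma smoothingB u v : smoothing (u - v) = smoothing u - smoothing v.
Proof.
apply: ap_fun_inj => x; rewrite ap_funB /= -mulrBr; congr (_ * _).
rewrite /convolution -meanB; [|exact: ap_conv_kernel..].
by congr mean; apply/funext => z; rewrite ap_funB mulrBl.
Qed.

Lemma smoothing_translate g u : smoothing (translate g u) = translate g (smoothing u).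
Proof.
apply: ap_fun_inj => x /=; congr (_ * _); rewrite /convolution.
rewrite -(mean_left g); last exact: ap_mul (apP _) (ap_kernel x).
by congr mean; apply/funext => z /=; rewrite mulKg invgM mulgA.
Qed.

Lemma translate1 u : translate 1%g u = u.
Proof. by apply: ap_fun_inj => x /=; rewrite invg1 mul1g. Qed.

Lemma translateM g h u : translate (g * h)%g u = translate g (translate h u).
Proof. by apply: ap_fun_inj => x /=; rewrite invgM mulgA. Qed.

Lemma translateB g u v : translate g (u - v) = translate g u - translate g v.
Proof. by apply: ap_fun_inj => x /=. Qed.

Lemma translate_ip g u : ap_ip (translate g u) (translate g u) = ap_ip u u.
Proof. exact: (mean_left g^-1%g (ap_mul (apP u) (apP u))). Qed.

Definition ap_tower := op_tower ap_ip translate smoothing.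

Lemma smoothing_bounded : exists2 C, 0 <= C &
  forall u, ipnorm ap_ip (smoothing u) <= C * ipnorm ap_ip u.
Proof.
have [C C0 FC] := ap_bounded FP; exists (d^-1 * C).
  by rewrite mulr_ge0 // invr_ge0 ltW.
move=> u; have di : 0 <= d^-1 by rewrite invr_ge0 ltW.
apply: ap_norm_le => [|x]; first by rewrite !mulr_ge0 // ipnorm_ge0.
by rewrite /= normrM ger0_norm // -mulrA ler_wpM2l // convolution_le.
Qed.

(** The cells on which [F] oscillates by at most [d] serve as cells of the
    tower, by [convolution_diff]. *)
Lemma ap_length_tower (T : finType) (k : G -> T) : modulus k d F ->
  length_tower #|T| 2 ap_tower.
Proof.
move=> kF; apply: op_length_tower.
- exact: ap_inner_product.
- exact: translate1.
- exact: translateM.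
- exact: translateB.
- exact: translate_ip.
- exact: smoothingB.
- exact: smoothing_sym.
- exact: smoothing_translate.
- exact: smoothing_bounded.
exists (fun x => enum_rank (k x)) => x y /enum_rank_inj kxy.
apply: op_tower_le => // u; rewrite mul1r.
apply: ap_norm_le => [|w]; first exact: ipnorm_ge0.
rewrite /displacement ap_funB /= -mulrBr normrM ger0_norm; last by rewrite invr_ge0 ltW.
rewrite ler_pdivrMl //; apply: convolution_diff; first exact: ltW.
move=> z; rewrite invgM invgK.
have := kF _ _ kxy (z^-1 * y^-1)%g w; rewrite -!mulgA mulKg distrC.
by rewrite !mulgA.
Qed.

Lemma ap_towerP g u :
  ipnorm ap_ip (smoothing u - translate g (smoothing u)) <=
  ap_tower 1 g * ipnorm ap_ip u.
Proof.
exact: (op_towerP ap_inner_product translate_ip smoothing_bounded 1 g u).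
Qed.

End Convolution.
End ApSpace.

(** * Towers from compact groups *)

(** Compactness is used in the form of near coverings along the filter of
    larger and larger finite lists. *)
Lemma compact_finite_net (K : topologicalType) (V : K -> set K) :
  compact [set: K] -> (forall y, nbhs y (V y)) ->
  exists s : seq K, forall x, exists2 y, y \in s & V y x.
Proof.
move=> /compact_near_coveringP cK nV.
pose Fs : set_system (seq K) := [set A : set (seq K) | exists s0 : seq K,
  forall s : seq K, {subset s0 <= s} -> A s].
have FF : Filter Fs.
  split=> [|A B [s As] [t Bt]|A B AB [s As]].
  - by exists [::].
  - exists (s ++ t) => u stu; split; [apply: As|apply: Bt] => z zs;
      by apply: stu; rewrite mem_cat zs ?orbT.
  - by exists s => u /As /AB.
have := cK _ Fs (fun s x => exists2 y, y \in s & V y x) FF.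
case=> [x _|s sP].
  exists (V x, [set s : seq K | x \in s]) => /=; last by move=> [x' s] /= [Vx' xs]; exists x.
  split=> //; exists [:: x] => s; apply; exact: mem_head.
by exists s => x; exact: sP.
Qed.

Section CompactGroup.
Variables (R : realType) (K : topologicalGroupType).
Hypothesis cK : compact [set: K].

Lemma mulg_cvg (T : Type) (F : set_system T) (f g : T -> K) (a b : K) : Filter F ->
  f @ F --> a -> g @ F --> b -> (fun t => f t * g t)%g @ F --> (a * b)%g.
Proof.
move=> FF fa gb.
apply: (@continuous2_cvg _ _ _ _ _ _ f g (fun x y => x * y)%g) => //.
exact: (@mulg_continuous K (a, b)).
Qed.

(** Compactness of the square of [K] makes the neighbourhoods uniform in the
    two translations. *)
Lemma continuous_modulus (phi : K -> R) e : continuous phi -> 0 < e ->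
  exists (T : finType) (k : K -> T), forall x y, k x = k y ->
    forall a b, `|phi (a * x * b)%g - phi (a * y * b)%g| <= e.
Proof.
move=> cphi e0; have e20 : 0 < e / 2 by lra.
pose V y := [set x | forall a b, `|phi (a * y * b)%g - phi (a * x * b)%g| <= e / 2].
have nV y : nbhs y (V y).
  have /compact_near_coveringP cKK := compact_setX cK cK.
  have := cKK _ (nbhs y) (fun x (p : K * K) =>
    `|phi (p.1 * y * p.2)%g - phi (p.1 * x * p.2)%g| <= e / 2) _.
  move=> H; suff : \forall x \near y, [set: K] `*` [set: K] `<=`
      (fun p : K * K => `|phi (p.1 * y * p.2)%g - phi (p.1 * x * p.2)%g| <= e / 2).
    by apply: filterS => x Hx a b; exact: (Hx (a, b)).
  apply: H => -[a b] _.
  pose q (t : K * K * K) := phi (t.1.1 * y * t.1.2)%g - phi (t.1.1 * t.2 * t.1.2)%g.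
  have c1 : (fun t : K * K * K => t.1.1) @ ((a, b), y) --> a.
    by apply: (@cvg_comp _ _ _ fst fst _ (nbhs (a, b))); exact: cvg_fst.
  have c2 : (fun t : K * K * K => t.1.2) @ ((a, b), y) --> b.
    by apply: (@cvg_comp _ _ _ fst snd _ (nbhs (a, b))); [exact: cvg_fst|exact: cvg_snd].
  have c3 : (fun t : K * K * K => t.2) @ ((a, b), y) --> y by exact: cvg_snd.
  have cq : q @ ((a, b), y) --> q ((a, b), y).
    rewrite /q; apply: cvgB; (apply: continuous_cvg; first exact: cphi).
      apply: mulg_cvg => //; apply: mulg_cvg => //; exact: cvg_cst.
    by apply: mulg_cvg => //; apply: mulg_cvg.
  have q0 : q ((a, b), y) = 0 by rewrite /q /= subrr.
  move/cvgr_norm_le : cq; rewrite q0 normr0 => /(_ _ e20).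
  exact.
have [s sP] := compact_finite_net cK nV.
have rep x : exists i : 'I_(size s), V (nth 1%g s i) x.
  have [w ws Vw] := sP x; have lt_i : (index w s < size s)%N by rewrite index_mem.
  by exists (Ordinal lt_i); rewrite nth_index.
exists 'I_(size s), (fun x => sval (cid (rep x))) => x y.
case: cid => i /= Vx; case: cid => j /= Vy ij a b; subst j.
have := Vx a b; have := Vy a b; rewrite !ler_norml => /andP[? ?] /andP[? ?].
by apply/andP; split; lra.
Qed.

Hypothesis hK : hausdorff_space K.

Lemma bump (W : set K) : nbhs (1%g : K) W -> exists phi : K -> R,
  [/\ continuous phi, phi 1%g = 1, forall x, 0 <= phi x <= 1 &
      forall x, phi x != 0 -> W x].
Proof.
move=> nW; have nK := compact_normal hK cK.
have c1 : closed [set (1%g : K)].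
  exact/accessible_closed_set1/hausdorff_accessible.
have cW : closed (~` W°) by apply: open_closedC; exact: open_interior.
have [||phi [cphi p0 p1 p01]] := @urysohn_ext_itv K R nK (~` W°) [set 1%g] 0 1 cW c1.
- by apply/seteqP; split=> // x [/= nWx x1]; apply: nWx; rewrite x1; exact: nW.
- exact: ltr01.
exists phi; split=> //.
- by apply: p1; exists 1%g.
- by move=> x; have := p01 (phi x); rewrite /= in_itv /=; apply; exists x.
- move=> x px; apply: interior_subset; apply: contrapT => nWx.
  by move/eqP: px; apply; apply: p0; exists x.
Qed.

Lemma quotient_nbhs (U : set K) : nbhs (1%g : K) U -> exists2 W : set K,
  nbhs (1%g : K) W & forall a b c d, W a -> W b -> W c -> W d ->
    U ((a * b) * (c * d)^-1)%g.
Proof.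
move=> nU.
pose q (t : (K * K) * (K * K)) := ((t.1.1 * t.1.2) * (t.2.1 * t.2.2)^-1)%g.
have e1 : q ((1, 1), (1, 1))%g = 1%g by rewrite /q /= !(mulg1, invg1).
have cq : q @ ((1%g, 1%g), (1%g, 1%g)) --> (1%g : K).
  rewrite -[X in _ --> X]e1; apply: mulg_cvg.
    apply: (@cvg_comp _ _ _ fst (fun p : K * K => (p.1 * p.2)%g)).
      exact: cvg_fst.
    exact: mulg_continuous.
  apply: (@cvg_comp _ _ _ snd (fun p : K * K => ((p.1 * p.2)^-1)%g)).
    exact: cvg_snd.
  apply: (@cvg_comp _ _ _ (fun p : K * K => (p.1 * p.2)%g) (fun x => x^-1)%g).
    exact: mulg_continuous.
  exact: invg_continuous.
have [[A B] [[[A1 A2] [nA1 nA2] A12] [[B1 B2] [nB1 nB2] B12]] /= AB] := cq _ nU.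
exists (A1 `&` A2 `&` (B1 `&` B2)); first by do ?apply: filterI.
move=> a b c d [[a1 a2] _] [[b1 b2] _] [_ [c1 c2]] [_ [d1 d2]].
apply: (AB ((a, b), (c, d))); split => /=; [exact: (A12 (a, b))|exact: (B12 (c, d))].
Qed.

(** Let [F] be the pullback of a symmetric bump function supported near [1]. If
    [pi g] is outside [U], then the convolution square [v] of [F] and its
    translate by [g] have disjoint supports, so the translation moves [v] by at
    least its own norm. Choosing the scale [d] from the norm of [v], this
    contradicts a small length of [g]. *)
Lemma compact_tower (G : groupType) (pi : UMagmaMorphism.type G K) (U : set K) :
  nbhs (1%g : K) U -> exists N B (l : nat -> G -> R),
    length_tower N B l /\ forall g, l 1%N g <= 3 * B -> U (pi g).
Proof.
move=> /quotient_nbhs[W /bump[phi [cphi phi1 phi01 phiW]] WU].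
pose F (x : G) := phi (pi x) * phi (pi x^-1%g).
have fP : almost_periodic (fun x => phi (pi x)).
  move=> e e0; have [T [k kP]] := continuous_modulus cphi e0.
  exists T, (fun x => k (pi x)) => x y kxy a b.
  by rewrite !gmulfM; exact: kP.
have FP : almost_periodic F by exact: ap_mul fP (ap_inv fP).
have F_sym x : F x^-1%g = F x by rewrite /F invgK mulrC.
have F01 x : 0 <= F x <= 1.
  have /andP[p0 p1] := phi01 (pi x); have /andP[q0 q1] := phi01 (pi x^-1%g).
  by rewrite /F mulr_ge0 //= mulr_ile1.
have F0 x : 0 <= F x by case/andP: (F01 x).
have F1 : F 1%g = 1 by rewrite /F invg1 gmulf1 phi1 mulr1.
have FW x : F x != 0 -> W (pi x).
  by rewrite mulf_eq0 negb_or => /andP[p _]; exact: phiW.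
pose h := mk_ap FP; pose v := convolution F h.
have vP : almost_periodic v by exact: ap_convolution.
have v0 x : 0 <= v x.
  apply: mean_ge0 => [|z]; first exact: ap_conv_kernel.
  by rewrite mulr_ge0 // F0.
have v1 : 0 < v 1%g.
  apply: (@mean_gt0 _ _ _ 1%g); first exact: ap_conv_kernel.
    by move=> z; rewrite mulr_ge0 // F0.
  by rewrite /= invg1 mulg1 F1 mulr1.
pose m := mean (fun x => v x * v x).
have vvP := ap_mul vP vP.
have m0 : 0 < m.
  by apply: (@mean_gt0 _ _ _ 1%g) => // [x|]; [exact: mulr_ge0|exact: mulr_gt0].
(* Smoothing at this scale gives [h] the norm [7], which exceeds the bound
   [3 * 2] for the displacement of an element of small length. *)
pose d := Num.sqrt m / 7.
have d0 : 0 < d by rewrite divr_gt0 // sqrtr_gt0.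
have [T [k kF]] := FP _ d0.
exists #|T|, 2, (ap_tower FP F_sym d).
split=> [|g lg]; first exact: (ap_length_tower FP F_sym d0 kF).
apply: contrapT => nUg.
have vW x : v x != 0 -> exists z, W (pi z) /\ W (pi (z^-1 * x)%g).
  move=> vx; apply: contrapT => nz; move/eqP: vx; apply.
  rewrite /v /convolution (_ : (fun z => _) = (fun=> 0)) ?mean_cst //.
  apply/funext => z; apply/eqP; rewrite mulf_eq0; apply/negPn/negP.
  by rewrite negb_or => /andP[/FW ? /FW ?]; apply: nz; exists z.
have disj x : v x * v (g^-1 * x)%g = 0.
  apply/eqP; apply/negPn/negP; rewrite mulf_eq0 negb_or => /andP[/vW[z [z1 z2]]].
  move=> /vW[t [t1 t2]]; apply: nUg; have := WU _ _ _ _ z1 z2 t1 t2.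
  by rewrite -!gmulfM !mulVKg -gmulfV -gmulfM invgM invgK mulVKg.
have := ap_towerP FP F_sym d0 g h; set s := smoothing _ _ _ _.
have hn : ipnorm (@ap_ip R G) h <= 1.
  by apply: ap_norm_le => // x; rewrite ger0_norm ?F0 //; case/andP: (F01 x).
move=> le6; have {le6} : ipnorm (@ap_ip R G) (s - translate g s) <= 6.
  rewrite (le_trans le6) // (_ : 6 = 3 * 2 * 1); last by lra.
  apply: ler_pM => //; last exact: ipnorm_ge0.
  by apply: op_tower_ge0; [exact: ap_inner_product|exact: translate_ip|
    exact: smoothing_bounded].
rewrite -(@ler_pXn2r _ 2) // ?nnegrE ?ipnorm_ge0 //.
rewrite (ipnorm_sqr (@ap_inner_product R G)).
apply/negP; rewrite -ltNge; apply: (@lt_le_trans _ _ 49); first by rewrite expr2; lra.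
have -> : 49 = d^-1 ^+ 2 * m.
  rewrite /d invf_div exprMn exprVn sqr_sqrtr ?ltW //.
  by rewrite divfK ?gt_eqF // expr2; lra.
rewrite -meanZ //; apply: le_mean.
- exact: (ap_mul (ap_cst G (d^-1 ^+ 2)) vvP).
- exact: ap_mul (apP _) (apP _).
move=> x; rewrite ap_funB /= -mulrBr -/v.
have -> : d^-1 * (v x - v (g^-1 * x)%g) * (d^-1 * (v x - v (g^-1 * x)%g)) =
  d^-1 ^+ 2 * (v x * v x + v (g^-1 * x)%g ^+ 2 - 2 * (v x * v (g^-1 * x)%g)) by ring.
by rewrite disj mulr0 subr0 ler_wpM2l ?sqr_ge0 // lerDl sqr_ge0.
Qed.

End CompactGroup.

(** * Towers from unitary representations *)

Local Open Scope complex_scope.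

Section ComplexVectors.
Variables (R : realType) (n : nat).
Local Notation V := 'cV[R[i]]_n.
Local Notation normc := ComplexField.Normc.normc.
Implicit Types u v w : V.

Lemma normc_sqr (z : R[i]) : normc z ^+ 2 = complex.Re z ^+ 2 + complex.Im z ^+ 2.
Proof. by case: z => a b /=; rewrite sqr_sqrtr // addr_ge0 ?sqr_ge0. Qed.

Lemma normc_ge0 (z : R[i]) : 0 <= normc z.
Proof. by case: z => a b /=; exact: sqrtr_ge0. Qed.

Lemma normc_le_ReIm (z : R[i]) : normc z <= `|complex.Re z| + `|complex.Im z|.
Proof.
rewrite -(@ler_pXn2r _ 2) // ?nnegrE ?normc_ge0 ?addr_ge0 //.
rewrite normc_sqr -(real_normK (num_real (complex.Re z))).
rewrite -(real_normK (num_real (complex.Im z))) sqrrD.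
have := mulr_ge0 (normr_ge0 (complex.Re z)) (normr_ge0 (complex.Im z)); lra.
Qed.

Lemma normc_sum (I : Type) (s : seq I) (F : I -> R[i]) :
  normc (\sum_(i <- s) F i) <= \sum_(i <- s) normc (F i).
Proof.
elim: s => [|i s IH]; first by rewrite !big_nil ComplexField.Normc.normc0.
by rewrite !big_cons (le_trans (le_normcD _ _)) // lerD2l.
Qed.

Definition cip u v : R :=
  \sum_j (complex.Re (u j 0) * complex.Re (v j 0) +
          complex.Im (u j 0) * complex.Im (v j 0)).

Lemma ReD (x y : R[i]) : complex.Re (x + y) = complex.Re x + complex.Re y.
Proof. by case: x; case: y. Qed.
Lemma ImD (x y : R[i]) : complex.Im (x + y) = complex.Im x + complex.Im y.
Proof. by case: x; case: y. Qed.
Lemma ReZ (a : R) (x : R[i]) : complex.Re (a%:C * x) = a * complex.Re x.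
Proof. by case: x => b c /=; rewrite mul0r subr0. Qed.
Lemma ImZ (a : R) (x : R[i]) : complex.Im (a%:C * x) = a * complex.Im x.
Proof. by case: x => b c /=; rewrite mul0r addr0. Qed.

Lemma cipZ (a : R) u v : cip (a%:C *: u) v = a * cip u v.
Proof.
by rewrite /cip mulr_sumr; apply: eq_bigr => j _; rewrite mxE ReZ ImZ; ring.
Qed.

Lemma cipC u v : cip u v = cip v u.
Proof. by apply: eq_bigr => j _; ring. Qed.

Lemma cipD u v w : cip (u + v) w = cip u w + cip v w.
Proof.
by rewrite /cip -big_split; apply: eq_bigr => j _; rewrite mxE ReD ImD /=; ring.
Qed.

Lemma cip_ge0 u : 0 <= cip u u.
Proof. by apply: sumr_ge0 => j _; rewrite -!expr2 addr_ge0 ?sqr_ge0. Qed.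

Lemma cip_inner_product : inner_product cip.
Proof.
split=> [||u|u v]; [exact: cipC|exact: cipD|exact: cip_ge0|].
apply: discriminant_le => [|t]; first exact: cip_ge0.
have := cip_ge0 (u + t%:C *: v); rewrite !cipD (cipC u) (cipC _ (u + _)) !cipD.
by rewrite !cipZ (cipC v (_ *: _)) (cipC u (_ *: _)) !cipZ (cipC v u); lra.
Qed.

Lemma l2normE u : l2norm u = ipnorm cip u.
Proof.
congr Num.sqrt; apply: eq_bigr => j _.
by rewrite normc_sqr !expr2.
Qed.

Lemma cip_complex u : (cip u u)%:C = (map_mx Num.conj u^T *m u) 0 0.
Proof.
rewrite mxE /cip rmorph_sum; apply: eq_bigr => j _.
by rewrite !mxE [RHS]mulrC -normCK -add_Re2_Im2 !expr2.
Qed.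

Lemma cip_unitary (A : 'M[R[i]]_n) u : A \is unitarymx -> cip (A *m u) (A *m u) = cip u u.
Proof.
move=> /unitarymxP /mulmx1C AA.
suff : (cip (A *m u) (A *m u))%:C = (cip u u)%:C by case.
rewrite !cip_complex trmx_mul map_mxM mulmxA.
by rewrite -[X in X *m u]mulmxA AA mulmx1.
Qed.

Lemma l2norm_unitary (A : 'M[R[i]]_n) u : A \is unitarymx -> l2norm (A *m u) = l2norm u.
Proof. by move=> uA; rewrite !l2normE /ipnorm cip_unitary. Qed.

Lemma entry_le_l2norm u i : normc (u i 0) <= l2norm u.
Proof.
rewrite -(@ler_pXn2r _ 2) // ?nnegrE ?normc_ge0 ?sqrtr_ge0 //.
rewrite sqr_sqrtr; last by apply: sumr_ge0 => j _; exact: sqr_ge0.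
by rewrite (bigD1 i) //= lerDl; apply: sumr_ge0 => j _; exact: sqr_ge0.
Qed.

Lemma l2norm_le_sum u : l2norm u <= \sum_i normc (u i 0).
Proof.
rewrite /l2norm -(@ler_pXn2r _ 2) // ?nnegrE ?sqrtr_ge0 //; last first.
  by apply: sumr_ge0 => j _; exact: normc_ge0.
rewrite sqr_sqrtr; last by apply: sumr_ge0 => j _; exact: sqr_ge0.
rewrite [leRHS]expr2 mulr_suml; apply: ler_sum => i _.
rewrite expr2 ler_wpM2l ?normc_ge0 // (bigD1 i) //= lerDl.
by apply: sumr_ge0 => j _; exact: normc_ge0.
Qed.

(** A crude bound is enough, since it is only used to choose a mesh depending
    on [n]. *)
Lemma l2norm_mul_le (A : 'M[R[i]]_n) u c : (forall i j, normc (A i j) <= c) ->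
  l2norm (A *m u) <= c *+ n *+ n * l2norm u.
Proof.
move=> Ac; rewrite (le_trans (l2norm_le_sum _)) //.
have -> : c *+ n *+ n * l2norm u = \sum_(i < n) \sum_(j < n) (c * l2norm u).
  by rewrite !sumr_const !card_ord !mulrnAl.
apply: ler_sum => i _; rewrite mxE (le_trans (normc_sum _ _)) //.
apply: ler_sum => j _; rewrite ComplexField.Normc.normcM.
by apply: ler_pM; rewrite ?normc_ge0 //; exact: entry_le_l2norm.
Qed.

Lemma l2norm_delta j : l2norm (delta_mx j 0 : V) <= 1.
Proof.
rewrite (le_trans (l2norm_le_sum _)) // (bigD1 j) //= big1 => [|k kj].
  by rewrite mxE !eqxx addr0 ComplexField.Normc.normc1.
by rewrite mxE (negPf kj) ComplexField.Normc.normc0.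
Qed.

Lemma unitary_entry_le1 (A : 'M[R[i]]_n) i j : A \is unitarymx -> normc (A i j) <= 1.
Proof.
move=> uA; have := entry_le_l2norm (A *m delta_mx j 0) i.
by rewrite l2norm_unitary // -colE mxE => /le_trans; apply; exact: l2norm_delta.
Qed.

Lemma opnorm_le (A : 'M[R[i]]_n) c : (forall u, l2norm (A *m u) <= c * l2norm u) ->
  0 <= c -> opnorm A <= c.
Proof.
move=> Ac c0; apply: ge_sup => [|_ [v /= v1 <-]].
  exists (l2norm (A *m 0)), 0 => //=; rewrite l2normE /ipnorm.
  by rewrite (ip0l cip_inner_product) sqrtr0.
by rewrite (le_trans (Ac v)) // ler_piMr.
Qed.

Lemma le_opnorm (A : 'M[R[i]]_n) c u : (forall u, l2norm (A *m u) <= c * l2norm u) ->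
  0 <= c -> l2norm u <= 1 -> l2norm (A *m u) <= opnorm A.
Proof.
move=> Ac c0 u1; apply: ub_le_sup; last by exists u.
exists c => _ [v /= v1 <-]; by rewrite (le_trans (Ac v)) // ler_piMr.
Qed.

End ComplexVectors.

(** The entries of a unitary matrix lie in the unit disc, so a fine enough grid
    for their real and imaginary parts has finitely many cells. *)
Lemma unitary_cells (R : realType) (n : nat) (d : R) : 0 < d ->
  exists (T : finType) (k : unitary_group R n -> T), forall A B, k A = k B ->
    forall u, l2norm ((A : 'M[R[i]]_n) *m u - (B : 'M[R[i]]_n) *m u) <= d * l2norm u.
Proof.
move=> d0; pose m := Num.bound ((1 *+ n *+ n) * 2 / d : R).
have mP : (1 *+ n *+ n) * 2 / d < m%:R.
  apply: archi_boundP; apply: divr_ge0; last exact: ltW.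
  by rewrite mulr_ge0 // !mulrn_wge0.
have m0 : (0 < m)%N.
  rewrite -(ltr0n R); apply: le_lt_trans mP; apply: divr_ge0; last exact: ltW.
  by rewrite mulr_ge0 // !mulrn_wge0.
have m0R : 0 < m%:R :> R by rewrite ltr0n.
pose cell (x : R) : 'I_(m + m).+1 := inord (Num.truncn ((x + 1) * m%:R)).
have cellP (x y : R) : `|x| <= 1 -> `|y| <= 1 -> cell x = cell y -> `|x - y| <= m%:R^-1.
  have rng (z : R) : `|z| <= 1 -> (Num.truncn ((z + 1) * m%:R) < (m + m).+1)%N /\
      0 <= (z + 1) * m%:R.
    rewrite ler_norml => /andP[z1 z2].
    have z0 : 0 <= (z + 1) * m%:R by rewrite mulr_ge0 //; lra.
    split=> //; rewrite truncn_lt_nat // -natr1 natrD.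
    have : (z + 1) * m%:R <= 2 * m%:R by rewrite ler_pM2r //; lra.
    lra.
  move=> /rng[x1 x0] /rng[y1 y0] /(congr1 val); rewrite /= !inordK // => xy.
  have := truncn_itv x0; have := truncn_itv y0; rewrite xy.
  set t := Num.truncn _; rewrite -(natr1 t) => /andP[ty yt] /andP[tx xt].
  rewrite -(ler_pM2r m0R) mulVf ?gt_eqF //.
  have -> : `|x - y| * m%:R = `|(x - y) * m%:R| by rewrite normrM (gtr0_norm m0R).
  by rewrite ler_norml; apply/andP; split; lra.
exists {ffun 'I_n * 'I_n -> 'I_(m + m).+1 * 'I_(m + m).+1}.
exists (fun A => [ffun p => (cell (complex.Re ((A : 'M[R[i]]_n) p.1 p.2)),
                             cell (complex.Im ((A : 'M[R[i]]_n) p.1 p.2)))]).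
move=> A B kAB u; rewrite -mulmxBl.
have bnd (C : unitary_group R n) i j : `|complex.Re ((C : 'M[R[i]]_n) i j)| <= 1 /\
    `|complex.Im ((C : 'M[R[i]]_n) i j)| <= 1.
  have := unitary_entry_le1 i j (valP C); set z := val C i j.
  rewrite -(@ler_pXn2r _ 2) // ?nnegrE ?normc_ge0 // expr1n normc_sqr => z1.
  by split; rewrite -(@ler_pXn2r _ 2) // ?nnegrE // expr1n real_normK ?num_real //;
     apply: le_trans z1; rewrite ?lerDl ?lerDr sqr_ge0.
rewrite (le_trans (l2norm_mul_le u (c := 2 * m%:R^-1) _)) //.
  move=> i j; have /ffunP/(_ (i, j)) := kAB; rewrite !ffunE => -[/= cR cI].
  rewrite !mxE (le_trans (normc_le_ReIm _)) // mulr_natl mulr2n.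
  have [A1 A2] := bnd A i j; have [B1 B2] := bnd B i j.
  have := cellP _ _ A1 B1 cR; have := cellP _ _ A2 B2 cI.
  by case: ((A : 'M[R[i]]_n) i j) => a b; case: ((B : 'M[R[i]]_n) i j) => a' b' /= ? ?; exact: lerD.
rewrite ler_wpM2r //; first exact: sqrtr_ge0.
have -> : 2 / m%:R *+ n *+ n = ((1 *+ n *+ n) * 2 / d) * (d / m%:R) :> R.
  have e (x : R) : x *+ n *+ n = x * (n%:R * n%:R) by rewrite mulrA !mulr_natr.
  by rewrite !e; field; rewrite (gt_eqF m0R) (gt_eqF d0).
have dm : 0 <= d / m%:R by apply: divr_ge0; [exact: ltW|exact: ltW].
apply: le_trans (ler_wpM2r dm (ltW mP)) _.
by rewrite mulrCA divff ?mulr1 // gt_eqF.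
Qed.

(** The operator [T] is the scalar [d^-1], so that [l 1 g] is the norm of
    [1 - pi g] divided by [d]. *)
Lemma unitary_tower (R : realType) (n : nat) (d : R) : 0 < d ->
  exists N, forall (G : groupType) (pi : UMagmaMorphism.type G (unitary_group R n)),
  exists B (l : nat -> G -> R), length_tower N B l /\
    forall g, l 1%N g <= 3 * B -> opnorm (1%:M - (pi g : 'M[R[i]]_n)) <= 6 * d.
Proof.
move=> d0; have [T [k kP]] := unitary_cells n d0; exists #|T| => G pi.
pose lam (g : G) (u : 'cV[R[i]]_n) := (pi g : 'M[R[i]]_n) *m u.
pose S (u : 'cV[R[i]]_n) := (d^-1)%:C *: u.
have ipV := @cip_inner_product R n.
have lam1 u : lam 1%g u = u by rewrite /lam gmulf1 mul1mx.
have lamM g h u : lam (g * h)%g u = lam g (lam h u) by rewrite /lam gmulfM mulmxA.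
have lamB g u v : lam g (u - v) = lam g u - lam g v by rewrite /lam mulmxBr.
have lam_ip g u : cip (lam g u) (lam g u) = cip u u by exact: cip_unitary (valP (pi g)).
have SB u v : S (u - v) = S u - S v by rewrite /S scalerBr.
have S_sym u v : cip (S u) v = cip u (S v) by rewrite cipZ cipC -cipZ cipC.
have S_lam g u : S (lam g u) = lam g (S u) by rewrite /S /lam scalemxAr.
have d1 : 0 <= d^-1 by rewrite invr_ge0 ltW.
have S_norm u : ipnorm (@cip R n) (S u) = d^-1 * ipnorm (@cip R n) u.
  by rewrite /ipnorm cipZ cipC cipZ mulrA -expr2 sqrtrM ?sqr_ge0 // sqrtr_sqr ger0_norm.
have S_bd : exists2 C, 0 <= C &
    forall u, ipnorm (@cip R n) (S u) <= C * ipnorm (@cip R n) u.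
  by exists d^-1 => // u; rewrite S_norm.
exists 2, (op_tower (@cip R n) lam S); split.
  apply: op_length_tower => //.
  exists (fun x => enum_rank (k (pi x))) => x y /enum_rank_inj kxy.
  apply: op_tower_le => // u; rewrite mul1r /= /displacement.
  have -> : S u - lam (x^-1 * y)%g (S u) = lam x^-1%g (lam x (S u) - lam y (S u)).
    by rewrite lamB -!lamM mulVg lam1.
  have -> w : ipnorm (@cip R n) (lam x^-1%g w) = ipnorm (@cip R n) w.
    by rewrite /ipnorm lam_ip.
  apply: (@le_trans _ _ (d * l2norm (S u))).
    by rewrite -l2normE; exact: (kP _ _ kxy (S u)).
  by rewrite l2normE S_norm mulrA divff ?mul1r // gt_eqF.
move=> g lg; apply: opnorm_le => [u|]; last by rewrite mulr_ge0 // ltW.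
have := op_towerP ipV lam_ip S_bd 1 g u; rewrite /= /displacement -S_lam -SB S_norm.
rewrite ler_pdivrMl // mulmxBl mul1mx !l2normE => /le_trans; apply.
rewrite mulrA; apply: ler_wpM2r; first exact: ipnorm_ge0.
have := ler_wpM2l (ltW d0) lg; lra.
Qed.

(** * Construction of strongly Bohr convergent sequences *)

Section GroupClosed.
Variables (G : groupType) (H : set G).
Hypothesis sH : subgrp H.

Definition subgrp_pred : {pred G} := fun x => `[< H x >].

Lemma subgrp_predP x : reflect (H x) (x \in subgrp_pred).
Proof. exact: asboolP. Qed.

Lemma groupClosed_subgrp : exists K : groupClosed G, forall x, x \in K <-> H x.
Proof.
have [H1 HM HV] := sH.
have p1 : 1%g \in subgrp_pred by exact/subgrp_predP.
have pM : mulg_closed subgrp_pred.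
  by move=> x y /subgrp_predP Hx /subgrp_predP Hy; apply/subgrp_predP/HM.
have pV : invg_closed subgrp_pred.
  by move=> x /subgrp_predP Hx; apply/subgrp_predP/HV.
pose P : {pred G} := subgrp_pred.
pose K := HB.pack_for (groupClosed G) P (isMulClosed.Build _ P pM)
  (isMul1Closed.Build _ P p1) (isInvClosed.Build _ P pV).
by exists K => x; split=> [/subgrp_predP|/subgrp_predP].
Qed.

End GroupClosed.

Lemma groupClosed_is_subgrp (G : groupType) (H : groupClosed G) :
  subgrp [set x | x \in H].
Proof.
split=> [|x y Hx Hy|x Hx] /=; [exact: gpred1|exact: gpredM|].
by rewrite gpredV.
Qed.

Lemma finitely_generated_gen (G : groupType) : finitely_generated G ->
  exists S : seq G, forall x, generated [set` S] x.
Proof.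
case=> S HS; exists S => x H sH SH.
have [K KH] := groupClosed_subgrp sH.
by apply/KH/HS => y yS; apply/KH; exact: SH.
Qed.

Lemma virtually_abelianP (G : groupType) : virtually_abelian G <->
  exists K : set G, [/\ subgrp K, fin_idx K & forall x y, K x -> K y -> commute x y].
Proof.
split=> [[H [cH fH]]|[K [sK [s Ks] cK]]].
  exists [set x | x \in H]; split; [exact: groupClosed_is_subgrp| |].
    have /finite_seqP[t tE] := fH.
    exists [seq xget 1%g [set y | left_coset H y = (A : set G)] | A <- t] => x.
    have xt : left_coset H x \in t by have : range (left_coset H) (left_coset H x) by [exists x]; rewrite tE.
    exists (xget 1%g [set y | left_coset H y = left_coset H x]).
      exact: (map_f (fun A : set G => xget 1%g [set y | left_coset H y = A])).
    case: xgetP => [y _ /= yx|/(_ x) []//].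
    have : left_coset H x x by exists 1%g; rewrite ?mulg1 //; exact: gpred1.
    by rewrite -yx => -[h /= Hh <-]; rewrite mulKg.
  by move=> x y; exact: cH.
have [H HK] := groupClosed_subgrp sK; exists H; split.
  by move=> x y /HK ? /HK ?; exact: cK.
apply: (@sub_finite_set _ _ (left_coset H @` [set` s])); last first.
  by apply: finite_image; exact: finite_seq.
move=> _ [x _ <-]; have [w ws Kw] := Ks x; exists w => //.
apply/seteqP; split=> _ [h /= Hh <-].
  exists ((w^-1 * x)^-1 * h)%g; last by rewrite invgM invgK -!mulgA mulVKg.
  by apply: gpredM => //; rewrite gpredV; apply/HK.
by exists (w^-1 * x * h)%g; [apply: gpredM => //; apply/HK|rewrite !mulgA mulgV mul1g].
Qed.

Lemma length_tower_widen (R : realType) (G : groupType) N N' B (l : nat -> G -> R) :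
  (N <= N')%N -> length_tower N B l -> length_tower N' B l.
Proof.
move=> NN' [? ? ? ? ? ? ? ? [k kP]]; split=> //.
exists (fun x => widen_ord NN' (k x)) => x y kxy.
by apply: kP; apply: val_inj; exact: (congr1 val kxy).
Qed.

Lemma sup_nonneg (R : realType) (A : set R) : (forall a, A a -> 0 <= a) -> 0 <= sup A.
Proof.
move=> A0; have [[[a Aa] ub]|/sup_out->//] := pselect (has_sup A).
exact: le_trans (A0 a Aa) (ub_le_sup ub Aa).
Qed.

Lemma strongly_bohr_exists (R : realType) (G : groupType) :
  finitely_generated G -> ~ virtually_abelian G ->
  exists g : nat -> G, (forall k, g k <> 1%g) /\ strongly_bohr_convergent R g.
Proof.
move=> /finitely_generated_gen[S genS] nva.
have small N : exists g : G, g <> 1%g /\ forall B (l : nat -> G -> R),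
    length_tower N B l -> l 1%N g <= 3 * B.
  apply: contrapT => nex; apply/nva/virtually_abelianP.
  apply: (@small_virtually_abelian R G S N genS) => g gl.
  by apply: contrapT => g1; apply: nex; exists g.
have [g gP] := choice small; exists g; split=> [k|]; first by case: (gP k).
have glate N B (l : nat -> G -> R) k : (N <= k)%N -> length_tower N B l ->
    l 1%N (g k) <= 3 * B.
  by move=> Nk lT; apply: (gP k).2; exact: length_tower_widen lT.
split=> [K cK hK pi U /= nU|n].
  have [N [B [l [lT lU]]]] := compact_tower R cK hK pi nU.
  by exists N => // k /= Nk; apply: lU; exact: glate lT.
apply/cvgr0Pnorm_le => e e0.
have d0 : 0 < e / 6 by lra.
have [N NP] := unitary_tower n d0.
exists N => // k /= Nk.
set A := [set _ | _ in _].
have A_le : ubound A e.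
  move=> _ [pi _ <-]; have [B [l [lT lo]]] := NP G pi.
  have := lo (g k) (glate _ _ _ _ Nk lT); lra.
have A_ge : forall a, A a -> 0 <= a.
  move=> _ [pi _ <-]; apply: sup_nonneg => _ [v _ <-]; exact: sqrtr_ge0.
have [A0|/set0P/negP] := pselect (A !=set0); last first.
  by rewrite negbK => /eqP ->; rewrite sup0 normr0 ltW.
rewrite ger0_norm; last exact: sup_nonneg.
exact: ge_sup.
Qed.

(** * Characters of finitely generated abelian groups *)

Section Characters.
Variables (R : realType) (G : groupType).
Local Notation C := (R[i]).
Local Notation normc := (@ComplexField.Normc.normc R).
Implicit Types (Q H : set G) (chi : G -> C).

Lemma normcX (z : C) n : normc (z ^+ n) = normc z ^+ n.
Proof.
elim: n => [|n IH]; first by rewrite !expr0 ComplexField.Normc.normc1.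
by rewrite !exprS ComplexField.Normc.normcM IH.
Qed.

Lemma normc1_root (z : C) n : (0 < n)%N -> normc (z ^+ n) = 1 -> normc z = 1.
Proof.
by move=> n0 /eqP; rewrite normcX pexpr_eq1 ?normc_ge0 // => /eqP.
Qed.

Lemma normc1_neq0 (z : C) : normc z = 1 -> z != 0.
Proof.
move=> z1; apply/eqP => z0; move: z1; rewrite z0 ComplexField.Normc.normc0.
by move/eqP; rewrite eq_sym oner_eq0.
Qed.

Lemma normc1_conj (z : C) : normc z = 1 -> Num.conj z = z^-1.
Proof.
move=> z1; have z0 := normc1_neq0 z1.
apply: (mulfI z0); rewrite divff // -normCK -add_Re2_Im2 -normc_sqr z1 expr1n.
by [].
Qed.

Record character_on Q chi : Prop := CharacterOn {
  char_subgrp : subgrp Q;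
  charM : forall x y, Q x -> Q y -> chi (x * y)%g = chi x * chi y;
  char_norm : forall x, Q x -> normc (chi x) = 1
}.

Lemma char_neq0 Q chi x : character_on Q chi -> Q x -> chi x != 0.
Proof. by move=> cQ Qx; apply: normc1_neq0; exact: char_norm cQ _ Qx. Qed.

Lemma char1 Q chi : character_on Q chi -> chi 1%g = 1.
Proof.
move=> cQ; have [Q1 _ _] := char_subgrp cQ.
apply: (mulfI (char_neq0 cQ Q1)).
by rewrite -(charM cQ) // mulg1 mulr1.
Qed.

Lemma charV Q chi x : character_on Q chi -> Q x -> chi x^-1%g = (chi x)^-1.
Proof.
move=> cQ Qx; have [_ _ QV] := char_subgrp cQ.
apply: (mulfI (char_neq0 cQ Qx)).
by rewrite -(charM cQ) ?mulgV ?(char1 cQ) ?divff ?(char_neq0 cQ) //; exact: QV.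
Qed.

Lemma charX Q chi x n : character_on Q chi -> Q x -> chi (x ^+ n)%g = chi x ^+ n.
Proof.
move=> cQ Qx; elim: n => [|n IH]; first by rewrite expg0 (char1 cQ).
rewrite expgS (charM cQ) // ?IH ?exprS //.
exact: subgrpX (char_subgrp cQ) Qx.
Qed.

(** The condition for [zeta] to be the value at [a] of a character that extends
    [chi] to the subgroup generated by [Q] and [a]. *)
Definition compatible Q chi a (zeta : C) : Prop :=
  normc zeta = 1 /\ forall k, Q (a ^+ k)%g -> chi (a ^+ k)%g = zeta ^+ k.

Lemma least_power Q a : subgrp Q ->
  (exists m, [/\ (0 < m)%N, Q (a ^+ m)%g & forall k, Q (a ^+ k)%g -> (m %| k)%N]) \/
  (forall k, Q (a ^+ k)%g -> k = 0%N).
Proof.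
move=> sQ; have [Q1 QM QV] := sQ.
have [ex|nex] := pselect (exists m, (0 < m)%N && `[< Q (a ^+ m)%g >]); last first.
  right=> -[//|k] Qk; case: nex; exists k.+1; exact/asboolP.
left; case: (ex_minnP ex) => m /andP[m0 /asboolP Qm] min_m; exists m; split=> // k Qk.
rewrite /dvdn; apply: contraT; rewrite -lt0n => r0.
suff /(min_m _) : (0 < k %% m)%N && `[< Q (a ^+ (k %% m))%g >].
  by rewrite leqNgt ltn_mod m0.
rewrite r0; apply/asboolP.
have -> : (a ^+ (k %% m) = ((a ^+ m) ^+ (k %/ m))^-1 * a ^+ k)%g.
  by rewrite {3}(divn_eq k m) expgnDr mulnC expgnA mulKg.
by apply: (QM) => //; apply: (QV); exact: subgrpX.
Qed.

(** The circle is divisible: when [m] is the least positive exponent with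
    [a ^+ m] in [Q], any [m]-th root of [chi (a ^+ m)] will do. *)
Lemma compatible_exists Q chi a : character_on Q chi -> exists zeta, compatible Q chi a zeta.
Proof.
move=> cQ; case: (least_power a (char_subgrp cQ)) => [[m [m0 Qm mk]]|k0].
  exists (m.-root (chi (a ^+ m)%g)); split.
    by apply: (normc1_root m0); rewrite rootCK //; exact: char_norm cQ _ Qm.
  move=> k Qk; have /dvdnP[q ->] := mk _ Qk.
  by rewrite mulnC expgnA exprM rootCK //; exact: (charX q cQ Qm).
exists 1; split=> [|k /k0->]; first exact: ComplexField.Normc.normc1.
by rewrite expg0 (char1 cQ).
Qed.

Lemma nontrivial_root_of_unity m : (1 < m)%N ->
  exists2 zeta : C, zeta != 1 & zeta ^+ m = 1.
Proof.
move=> m1; pose p : {poly C} := \poly_(i < m) 1.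
have sp : size p = m.
  by apply: size_poly_eq; rewrite oner_eq0.
have /closed_rootP[z pz] : size p != 1%N by rewrite sp gtn_eqF.
have Sz : \sum_(i < m) z ^+ i = 0.
  transitivity p.[z]; last exact/rootP.
  by rewrite horner_poly; apply: eq_bigr => i _; rewrite mul1r.
exists z; last by apply/eqP; rewrite -subr_eq0 subrX1 Sz mulr0.
apply/eqP => z1; move/eqP: Sz; rewrite z1.
under eq_bigr do rewrite expr1n.
by rewrite sumr_const card_ord pnatr_eq0 eqn0Ngt (ltnW m1).
Qed.

(** The trivial character of the trivial subgroup extends non-trivially to the
    cyclic group generated by [a]. *)
Lemma compatible_nontrivial a : a <> 1%g ->
  exists2 zeta, zeta != 1 & compatible [set 1%g] (fun=> 1) a zeta.
Proof.
move=> a1; have s1 : subgrp [set (1%g : G)].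
  by split=> [//|x y -> ->|x ->]; rewrite ?mulg1 ?invg1.
case: (least_power a s1) => [[m [m0 am mk]]|k0].
  have m1 : (1 < m)%N.
    rewrite ltn_neqAle m0 andbT; apply/eqP => m1; apply: a1.
    by move: am; rewrite -m1 expg1.
  have [z z1 zm] := nontrivial_root_of_unity m1; exists z => //; split.
    by apply: (normc1_root m0); rewrite zm ComplexField.Normc.normc1.
  by move=> k /mk /dvdnP[q ->]; rewrite mulnC exprM zm expr1n.
exists (- 1).
  by rewrite -subr_eq0 -opprD oppr_eq0 (_ : 1 + 1 = 2%:R) // pnatr_eq0.
split=> [|k /k0-> //].
by apply: (@normc1_root _ 2); rewrite // sqrrN expr1n ComplexField.Normc.normc1.
Qed.

(** Elements of the form [x0 a^j a^-i], written without inverses. *)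
Definition adjoin Q a : set G :=
  [set x | exists x0 i j, Q x0 /\ (x * a ^+ i = x0 * a ^+ j)%g].

(** Since the group is abelian, [chi x0 * zeta ^ j / zeta ^ i] depends only on
    [x0 a^j a^-i]. *)
Lemma character_extend H Q chi a zeta :
  subgrp H -> (forall x y, H x -> H y -> commute x y) -> Q `<=` H -> H a ->
  character_on Q chi -> compatible Q chi a zeta ->
  exists Q' chi', [/\ character_on Q' chi', Q' `<=` H, Q `<=` Q', Q' a &
    chi' a = zeta /\ forall x, Q x -> chi' x = chi x].
Proof.
move=> sH cH QH Ha cQ [z1 zQ]; have sQ := char_subgrp cQ.
have [Q1 QM QV] := sQ; have [H1 HM HV] := sH.
have z0 := normc1_neq0 z1.
have HX n : H (a ^+ n)%g by exact: subgrpX.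
(* [fits x c]: the value at [x] is forced to be [c]. *)
pose fits x (c : C) := exists x0 i j,
  [/\ Q x0, (x * a ^+ i = x0 * a ^+ j)%g & c * zeta ^+ i = chi x0 * zeta ^+ j].
have adjH : adjoin Q a `<=` H.
  move=> x [x0 [i [j [Qx0 e]]]].
  have -> : x = (x0 * a ^+ j * (a ^+ i)^-1)%g by rewrite -e mulgK.
  by apply: (HM); [apply: (HM) => //; exact: QH|exact: HV].
have compare x y m n : Q x -> Q y -> (n <= m)%N ->
    (x * a ^+ n = y * a ^+ m)%g -> chi x * zeta ^+ n = chi y * zeta ^+ m.
  move=> Qx Qy nm e.
  have e2 : x = (y * a ^+ (m - n))%g.
    by apply: (mulIg (a ^+ n)%g); rewrite e -mulgA -expgnDr subnK.
  have Qa : Q (a ^+ (m - n))%g.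
    have -> : (a ^+ (m - n) = y^-1 * x)%g by rewrite e2 mulKg.
    by apply: (QM) => //; exact: QV.
  by rewrite e2 (charM cQ) // zQ // -mulrA -exprD subnK.
have uniq x c c' : fits x c -> fits x c' -> c = c'.
  move=> [x0 [i [j [Qx0 ex ec]]]] [y0 [k [l [Qy0 ey ec']]]].
  have e : (x0 * a ^+ (j + k) = y0 * a ^+ (l + i))%g.
    rewrite !expgnDr !mulgA -ex -ey -!mulgA; congr (_ * _)%g.
    by rewrite -!expgnDr addnC.
  have : chi x0 * zeta ^+ (j + k) = chi y0 * zeta ^+ (l + i).
    have [le|/ltnW le] := leqP (j + k) (l + i); first exact: compare.
    by apply/esym; exact: compare.
  rewrite !exprD !mulrA -ec -ec' -!mulrA (mulrC (zeta ^+ i)).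
  by apply/mulIf; rewrite mulf_neq0 // expf_neq0.
have fitsM x y c c' : fits x c -> fits y c' -> H x -> H y -> fits (x * y)%g (c * c').
  move=> [x0 [i [j [Qx0 ex ec]]]] [y0 [k [l [Qy0 ey ec']]]] Hx Hy.
  exists (x0 * y0)%g, (i + k)%N, (j + l)%N; split; first exact: QM.
    have c1 : commute (a ^+ i)%g y by apply: cH.
    have c2 : commute (a ^+ j)%g y0 by apply: cH => //; exact: QH.
    rewrite !expgnDr !mulgA -(mulgA x) -(c1 : (_ * _ = _ * _)%g) mulgA ex -mulgA ey.
    by rewrite -!mulgA; congr (_ * _)%g; rewrite !mulgA (c2 : (_ * _ = _ * _)%g).
  rewrite !exprD (charM cQ) //.
  have -> : c * c' * (zeta ^+ i * zeta ^+ k) = (c * zeta ^+ i) * (c' * zeta ^+ k) by ring.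
  by rewrite ec ec'; ring.
have fitsQ x : Q x -> fits x (chi x).
  by move=> Qx; exists x, 0%N, 0%N.
have fits_ex x : adjoin Q a x -> exists c, fits x c.
  move=> [x0 [i [j [Qx0 e]]]]; exists (chi x0 * zeta ^+ j / zeta ^+ i).
  by exists x0, i, j; split=> //; rewrite divfK // expf_neq0.
pose chi' x := xget 0 [set c | fits x c].
have chi'P x : adjoin Q a x -> fits x (chi' x).
  by move=> /fits_ex[c xc]; rewrite /chi'; case: xgetP => [//|/(_ c) []].
have chi'E x c : fits x c -> chi' x = c.
  move=> xc; apply: uniq (xc); apply: chi'P.
  by case: xc => x0 [i [j [Qx0 e _]]]; exists x0, i, j.
exists (adjoin Q a), chi'; split=> //.
- split.
  + split.
    * by exists 1%g, 0%N, 0%N.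
    * move=> x y ax ay; have := fitsM _ _ _ _ (chi'P _ ax) (chi'P _ ay) (adjH _ ax) (adjH _ ay).
      by move=> [x0 [i [j [Qx0 e _]]]]; exists x0, i, j.
    * move=> x ax; have Hx := adjH _ ax.
      case: ax => x0 [i [j [Qx0 e]]]; exists x0^-1%g, j, i; split; first exact: QV.
      have cx : commute x^-1%g (a ^+ j)%g by apply: cH => //; exact: HV.
      have c0 : commute x0^-1%g (a ^+ i)%g by apply: cH => //; apply: HV; exact: QH.
      rewrite (cx : (_ * _ = _ * _)%g) (c0 : (_ * _ = _ * _)%g).
      have -> : (a ^+ j = x0^-1 * (x * a ^+ i))%g by rewrite e mulKg.
      have c1 : commute x (a ^+ i)%g by exact: cH.
      by rewrite (c1 : (_ * _ = _ * _)%g) !mulgA mulgK.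
  + move=> x y ax ay; apply: chi'E; apply: fitsM; rewrite ?adjH //; try exact: chi'P.
      exact: adjH.
    exact: adjH.
  + move=> x /chi'P[x0 [i [j [Qx0 e /(congr1 normc)]]]].
    rewrite !ComplexField.Normc.normcM !normcX z1 !expr1n !mulr1 => ->.
    exact: char_norm cQ _ Qx0.
- by move=> x Qx; exists x, 0%N, 0%N.
- by exists 1%g, 0%N, 1%N; rewrite expg0 mulg1 mul1g.
- split; first by apply: chi'E; exists 1%g, 0%N, 1%N;
    rewrite expg0 mulg1 mul1g (char1 cQ) mul1r mulr1.
  by move=> x Qx; apply: chi'E; exact: fitsQ.
Qed.

(** Start with a character of the cyclic group of [g] and adjoin the
    generators of [H] one at a time. *)
Lemma character_separates H (A : seq G) g :
  subgrp H -> (forall x y, H x -> H y -> commute x y) ->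
  H `<=` generated [set` A] -> [set` A] `<=` H -> H g -> g <> 1%g ->
  exists2 chi, character_on H chi & chi g != 1.
Proof.
move=> sH cH HA AH Hg g1; have [H1 HM HV] := sH.
have c1 : character_on [set (1%g : G)] (fun=> 1).
  split=> [|x y _ _|x _]; last exact: ComplexField.Normc.normc1.
    by split=> [//|x y -> ->|x ->]; rewrite ?mulg1 ?invg1.
  by rewrite mulr1.
have [zeta z1 zc] := compatible_nontrivial g1.
have [|Q [chi [cQ QH _ Qg [chig _]]]] := character_extend sH cH _ Hg c1 zc.
  by move=> x ->.
have {z1}chig1 : chi g != 1 by rewrite chig.
clear c1 zc chig.
suff [Q' [chi' [cQ' Q'H Q'g chi'g Q'A]]] : exists Q' chi',
    [/\ character_on Q' chi', Q' `<=` H, Q' g, chi' g != 1 & [set` A] `<=` Q'].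
  have HQ' : H `<=` Q' by move=> x /HA; apply; [exact: char_subgrp cQ'|].
  exists chi' => //; split=> // [x y /HQ' Qx /HQ' Qy|x /HQ' Qx].
    exact: charM cQ' _ _ Qx Qy.
  exact: char_norm cQ' _ Qx.
elim: A AH {HA} => [|a A IH] AH; first by exists Q, chi; split=> // x; rewrite /= in_nil.
have [x xA|Q' [chi' [cQ' Q'H Q'g chi'g Q'A]]] := IH.
  by apply: AH; rewrite /= inE xA orbT.
have Ha : H a by apply: AH; exact: mem_head.
have [xi xic] := compatible_exists a cQ'.
have [Q2 [chi2 [cQ2 Q2H Q'Q2 Q2a [_ chi2E]]]] := character_extend sH cH Q'H Ha cQ' xic.
exists Q2, chi2; split=> //; first exact: Q'Q2.
  by rewrite chi2E.
by move=> x /=; rewrite inE => /predU1P[->//|/Q'A /Q'Q2].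
Qed.

(** While [z ^ k] is within [1 / 2] of [1], squaring multiplies its distance
    from [1] by [|1 + z ^ k|], which is at least [3 / 2]. *)
Lemma powers_escape (z : C) : normc z = 1 -> z != 1 ->
  exists k, 1 / 2 <= normc (1 - z ^+ k).
Proof.
move=> z1 zn1; apply: contrapT => nex.
have lt k : normc (1 - z ^+ k) < 1 / 2.
  by rewrite ltNge; apply/negP => h; apply: nex; exists k.
have grow i : (3 / 2) ^+ i * normc (1 - z) <= normc (1 - z ^+ (2 ^ i)).
  elim: i => [|i IH]; first by rewrite expr0 mul1r expn0 expr1.
  set w := z ^+ (2 ^ i) in IH *.
  have -> : z ^+ (2 ^ i.+1) = w * w by rewrite expnS mul2n -addnn exprD.
  have -> : 1 - w * w = (1 - w) * (1 + w) by ring.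
  rewrite ComplexField.Normc.normcM exprS.
  have h : 3 / 2 <= normc (1 + w).
    have := le_normcD (1 + w) (1 - w); have := lt (2 ^ i)%N; rewrite -/w.
    have -> : 1 + w + (1 - w) = 1 *+ 2 by ring.
    rewrite normcMn ComplexField.Normc.normc1; lra.
  have h2 : (3 / 2) ^+ i * normc (1 - z) * (3 / 2) <= normc (1 - w) * normc (1 + w).
    by apply: ler_pM => //; apply: mulr_ge0; rewrite ?normc_ge0 ?exprn_ge0.
  by apply: le_trans h2; rewrite le_eqVlt; apply/orP; left; apply/eqP; ring.
have lin i : (i%:R : R) / 2 <= (3 / 2) ^+ i.
  elim: i => [|i IH]; first by rewrite mul0r expr0.
  rewrite -natr1 exprS; have : 1 <= (3 / 2 : R) ^+ i by apply: exprn_ege1; lra.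
  lra.
have d0 : 0 < normc (1 - z).
  rewrite lt_neqAle normc_ge0 andbT eq_sym; apply/eqP => /ComplexField.Normc.eq0_normc.
  by move/eqP; rewrite subr_eq0 eq_sym (negPf zn1).
have := archi_boundP (ltW (divr_gt0 ltr01 d0)); set m := Num.bound _.
rewrite ltr_pdivrMr // => mb.
have := lt (2 ^ m)%N; have := grow m.
have : m%:R / 2 * normc (1 - z) <= (3 / 2) ^+ m * normc (1 - z).
  by rewrite ler_pM2r.
lra.
Qed.

End Characters.

(** * Induced representations and the equivalence *)

(** The representative of a coset is its first element in the list that
    witnesses the finite index. *)
Lemma transversal (G : groupType) (H : set G) : subgrp H -> fin_idx H ->
  exists n (r : 'I_n -> G) (c : G -> 'I_n),
    forall x i, H ((r i)^-1 * x)%g <-> i = c x.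
Proof.
move=> sH [s Hs]; have [H1 HM HV] := sH.
pose rho x : G := nth 1%g s (find (fun w => `[< H (w^-1 * x)%g >]) s).
have rhoH x : H ((rho x)^-1 * x)%g.
  have [w ws Hw] := Hs x; apply/asboolP.
  apply: (@nth_find _ 1%g (fun w => `[< H (w^-1 * x)%g >])).
  by apply/hasP; exists w => //; exact/asboolP.
have rhos x : rho x \in s.
  have [w ws Hw] := Hs x; apply: mem_nth; rewrite -has_find.
  by apply/hasP; exists w => //; exact/asboolP.
have rhoE x y : H (x^-1 * y)%g -> rho x = rho y.
  move=> Hxy; rewrite /rho; congr nth; apply: eq_find => w.
  apply/asboolP/asboolP => Hw.
    have -> : (w^-1 * y = (w^-1 * x) * (x^-1 * y))%g by group_simp.
    exact: HM.
  have -> : (w^-1 * x = (w^-1 * y) * (x^-1 * y)^-1)%g by group_simp.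
  by apply: (HM) => //; exact: HV.
pose t := undup [seq rho w | w <- s].
have rhot x : rho x \in t.
  by rewrite mem_undup -(rhoE _ _ (rhoH x)); exact: map_f.
have tfix w : w \in t -> rho w = w.
  rewrite mem_undup => /mapP[v vs ->]; apply: rhoE; exact: rhoH.
have lt_c x : (index (rho x) t < size t)%N by rewrite index_mem.
exists (size t), (fun i : 'I_(size t) => nth 1%g t i), (fun x => Ordinal (lt_c x)).
move=> x i; split=> [Hi|->]; last by rewrite /= nth_index.
apply: val_inj => /=; rewrite -(rhoE _ _ Hi) tfix ?mem_nth //.
by rewrite index_uniq // undup_uniq.
Qed.

Section Induced.
Variables (R : realType) (G : groupType) (H : set G) (n : nat).
Variables (r : 'I_n -> G) (c : G -> 'I_n).
Hypothesis rc : forall x i, H ((r i)^-1 * x)%g <-> i = c x.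
Variable chi : G -> R[i].
Hypothesis cH : character_on H chi.

Let sH := char_subgrp cH.

Lemma coset_rep x : H ((r (c x))^-1 * x)%g. Proof. exact/rc. Qed.

Lemma coset_eq x y : H (x^-1 * y)%g -> c x = c y.
Proof.
move=> Hxy; apply/rc; have [_ HM _] := sH.
have -> : ((r (c x))^-1 * y = ((r (c x))^-1 * x) * (x^-1 * y))%g by group_simp.
by apply: HM => //; exact: coset_rep.
Qed.

(** The matrix of the representation induced from [chi], in the basis indexed
    by the left cosets of [H] with representatives [r]; [c x] is the index of
    the coset of [x]. *)
Definition induced (g : G) : 'M[R[i]]_n :=
  \matrix_(i, j) (if i == c (g * r j)%g then chi ((r i)^-1 * (g * r j))%g else 0).

Lemma induced1 : induced 1%g = 1%:M.
Proof.
apply/matrixP => i j; rewrite !mxE mul1g.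
have -> : c (r j) = j by apply/esym/rc; rewrite mulVg; case: sH.
by case: eqVneq => [->|//]; rewrite mulVg (char1 cH).
Qed.

Lemma inducedM g h : induced (g * h)%g = induced g *m induced h.
Proof.
apply/matrixP => i k; rewrite !mxE (bigD1 (c (h * r k)%g)) //= big1 ?addr0; last first.
  by move=> j /negPf jc; rewrite !mxE jc mulr0.
set j := c (h * r k)%g; rewrite !mxE eqxx.
have Hj : H ((r j)^-1 * (h * r k))%g by exact: coset_rep.
have -> : c (g * h * r k)%g = c (g * r j)%g.
  apply/esym/coset_eq; rewrite (_ : (_^-1 * _ = (r j)^-1 * (h * r k))%g) //.
  by group_simp.
case: eqVneq => [ij|_]; last by rewrite mul0r.
have Hi : H ((r i)^-1 * (g * r j))%g by rewrite ij; exact: coset_rep.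
by rewrite -(charM cH) //; congr chi; group_simp.
Qed.

Lemma induced_adjoint g : map_mx Num.conj (induced g)^T = induced g^-1%g.
Proof.
apply/matrixP => i j; rewrite !mxE; have [_ HM HV] := sH.
have inv : ((r i)^-1 * (g^-1 * r j) = ((r j)^-1 * (g * r i))^-1)%g by group_simp.
case: eqP => [/rc Hj|nj]; case: eqP => [/rc Hi|ni].
- by rewrite inv (charV cH) // normc1_conj // (char_norm cH).
- by case: ni; apply/rc; rewrite inv; exact: HV.
- by case: nj; apply/rc; rewrite -[X in H X]invgK -inv; exact: HV.
- by rewrite rmorph0.
Qed.

Lemma induced_unitary g : induced g \is unitarymx.
Proof. by apply/unitarymxP; rewrite induced_adjoint -inducedM mulgV induced1. Qed.

Definition induced_fun (g : G) : unitary_group R n := UnitaryGroup (induced_unitary g).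

Lemma induced_fun1 : induced_fun 1%g = 1%g.
Proof. by apply: val_inj; exact: induced1. Qed.

Lemma induced_funM : {morph induced_fun : x y / (x * y)%g}.
Proof. by move=> x y; apply: val_inj; exact: inducedM. Qed.

Definition induced_rep : UMagmaMorphism.type G (unitary_group R n) :=
  HB.pack_for (UMagmaMorphism.type G (unitary_group R n)) induced_fun
    (isMultiplicative.Build _ _ induced_fun induced_funM)
    (Multiplicative_isUMagmaMorphism.Build _ _ induced_fun induced_fun1).

Lemma induced_repE g : (induced_rep g : 'M[R[i]]_n) = induced g.
Proof. by []. Qed.

End Induced.

Lemma displacement_le2 (R : realType) (n : nat) (A : unitary_group R n) u :
  l2norm ((1%:M - (A : 'M[R[i]]_n)) *m u) <= 2 * l2norm u.
Proof.
rewrite mulmxBl mul1mx !l2normE (le_trans (ipnormB (@cip_inner_product R n) _ _)) //.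
by rewrite -!l2normE (l2norm_unitary _ (valP A)) mulr_natl mulr2n.
Qed.

Lemma entry_le_opnorm (R : realType) (n : nat) (A : unitary_group R n) i j :
  ComplexField.Normc.normc ((1%:M - (A : 'M[R[i]]_n)) i j) <=
  opnorm (1%:M - (A : 'M[R[i]]_n)).
Proof.
set D := 1%:M - _.
have := entry_le_l2norm (D *m delta_mx j 0) i; rewrite -colE mxE => /le_trans; apply.
rewrite colE; apply: (@le_opnorm _ _ _ 2) => //; last exact: l2norm_delta.
exact: displacement_le2.
Qed.

(** The dimension is the index of a finitely generated abelian subgroup [H].
    The coefficient at the coset of [1] is [chi g] for [g] in [H], and [0]
    otherwise; in the second case the trivial character suffices. *)
Lemma virtually_abelian_separated (R : realType) (G : groupType) :
  finitely_generated G -> virtually_abelian G ->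
  exists n, forall g : G, g <> 1%g ->
    exists pi : UMagmaMorphism.type G (unitary_group R n),
      1 / 2 <= opnorm (1%:M - (pi g : 'M[R[i]]_n)).
Proof.
move=> /finitely_generated_gen[S genS] /virtually_abelianP[K [sK fK cK]].
have [A AK fA] := fin_idx_fg genS sK fK.
set H := generated [set` A] in fA.
have sH : subgrp H by exact: generated_subgrp.
have HK : H `<=` K by exact: generated_min.
have cH x y : H x -> H y -> commute x y by move=> /HK Kx /HK; exact: cK.
have AH : [set` A] `<=` H by exact: sub_generated.
have [n [r [c rc]]] := transversal sH fA.
have [H1 HM HV] := sH.
exists n => g g1; pose i := c 1%g.
have Hri : H (r i).
  have := (rc 1%g i).2 erefl; rewrite mulg1 => /HV; by rewrite invgK.
have rig : H ((r i)^-1 * (g * r i))%g -> H g.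
  move=> h; have -> : (g = r i * ((r i)^-1 * (g * r i)) * (r i)^-1)%g by group_simp.
  by apply: (HM); [exact: HM|exact: HV].
have [Hg|nHg] := pselect (H g); last first.
  have c1 : character_on H (fun=> 1 : R[i]).
    by split=> // [x y _ _|x _]; [rewrite mulr1|exact: ComplexField.Normc.normc1].
  exists (induced_rep rc c1); apply: le_trans (entry_le_opnorm _ i i).
  rewrite induced_repE !mxE eqxx ifN.
    by rewrite subr0 ComplexField.Normc.normc1; lra.
  by apply/eqP => /rc /rig.
have [chi cchi chig] := character_separates R sH cH (@subset_refl _ H) AH Hg g1.
have [k kP] := powers_escape (char_norm cchi Hg) chig.
have ck : character_on H (fun x => chi x ^+ k).
  split=> // [x y Hx Hy|x Hx]; first by rewrite (charM cchi) // exprMn.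
  by rewrite normcX (char_norm cchi) // expr1n.
exists (induced_rep rc ck); apply: le_trans (entry_le_opnorm _ i i).
have e : ((r i)^-1 * (g * r i) = g)%g.
  by rewrite (cH _ _ Hg Hri : (_ * _ = _ * _)%g) mulKg.
rewrite induced_repE !mxE eqxx ifT ?e //.
by apply/eqP/rc; rewrite e.
Qed.

Theorem theorem1p1 (R : realType) (G : groupType)
    (Gfg : finitely_generated G) :
  (exists g : nat -> G,
     (forall k : nat, g k <> 1%g) /\ strongly_bohr_convergent R g)
  <-> ~ virtually_abelian G.
Proof.
split=> [[g [g1 [_ gU]]] va|]; last exact: strongly_bohr_exists.
have [n nP] := virtually_abelian_separated R Gfg va.
have h0 : 0 < 1 / 4 :> R by lra.
have /cvgr0Pnorm_lt/(_ _ h0)[N _ /(_ N (leqnn N))] := gU n.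
set A := [set _ | _ in _].
have [pi lepi] := nP (g N) (g1 N).
have : opnorm (1%:M - (pi (g N) : 'M[R[i]]_n)) <= sup A.
  apply: ub_le_sup; last by exists pi.
  by exists 2 => _ [rho _ <-]; apply: opnorm_le => // u; exact: displacement_le2.
move=> lesup; have := ler_norm (sup A); rewrite /=; lra.
Qed.
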